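(* Let $\lambda_1,\lambda_2\in(0,\infty)$, let $m=(m_1,m_2)\in\mathbb{R}^2$ be a unit vector and $D=\{x\in\mathbb{Z}^2: m\cdot x\geq 0\}$. If $(\log\lambda_1,\log\lambda_2)\neq-\|\log\vec\lambda\|(m_1,m_2)$, then $\gamma(H^D)>0$.
   Context: PVBS model on $\mathbb{Z}^2$ with parameters $\lambda_1,\lambda_2$: each site carries $\mathbb{C}^2$ with basis $|0\rangle,|1\rangle$; with $\phi^{(\lambda)}=(|01\rangle-\lambda|10\rangle)/\sqrt{1+\lambda^2}$ on the pair $(x,x+e_j)$ (first factor at $x$), $h_{x,x+e_j}=|\phi^{(\lambda_j)}\rangle\langle\phi^{(\lambda_j)}|+|11\rangle\langle11|$. $\log\vec\lambda=(\log\lambda_1,\log\lambda_2)$. $H^D$ is the Hamiltonian in the GNS representation of the all-$|0\rangle$ product state on $D$: its Hilbert space is the closure of the span of product vectors with finitely many sites of $D$ in $|1\rangle$, and $H^D$ is the self-adjoint closure of $\sum_{j}\sum_{x,x+e_j\in D}h_{x,x+e_j}$ on this span. For $H\geq0$ with $0\in\operatorname{spec}(H)$, $\gamma(H)=\sup\{\delta>0:\operatorname{spec}(H)\cap(0,\delta)=\emptyset\}$ (and $0$ if no such $\delta$). *)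

(* Defs.v *)
From Stdlib Require Import Bool Reals ZArith List.
Import ListNotations.
Open Scope R_scope.
Open Scope bool_scope.
Open Scope R_scope.

Definition site : Type := (Z * Z)%type.
(* a configuration: the set of sites in state |1> *)
Definition cfg : Type := site -> bool.

Definition cpx : Type := (R * R)%type.
Definition c0 : cpx := (0, 0).
Definition cadd (z w : cpx) : cpx := (fst z + fst w, snd z + snd w).
Definition csub (z w : cpx) : cpx := (fst z - fst w, snd z - snd w).
Definition cscale (r : R) (z : cpx) : cpx := (r * fst z, r * snd z).
Definition cabs2 (z : cpx) : R := fst z * fst z + snd z * snd z.
Definition csum (l : list cpx) : cpx := fold_right cadd c0 l.
Definition rsum (l : list R) : R := fold_right Rplus 0 l.

Definition inD (m1 m2 : R) (x : site) : Prop :=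
  0 <= m1 * IZR (fst x) + m2 * IZR (snd x).
Definition inDb (m1 m2 : R) (x : site) : bool :=
  if Rle_dec 0 (m1 * IZR (fst x) + m2 * IZR (snd x)) then true else false.

(* basis configurations of the GNS space of the all-|0> state on D:
   finitely many sites, all in D, are in |1> *)
Definition valid_cfg (m1 m2 : R) (eta : cfg) : Prop :=
  (forall x, eta x = true -> inD m1 m2 x) /\
  exists l : list site, forall x, eta x = true -> In x l.

Definition vec : Type := cfg -> cpx.
Definition vsub (u v : vec) : vec := fun e => csub (u e) (v e).
Definition vscale (r : R) (u : vec) : vec := fun e => cscale r (u e).

Definition sqnorm_le (u : vec) (r : R) : Prop :=
  forall L : list cfg, NoDup L -> rsum (map (fun e => cabs2 (u e)) L) <= r.

Definition in_l2 (m1 m2 : R) (u : vec) : Prop :=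
  (forall e, ~ valid_cfg m1 m2 e -> u e = c0) /\ exists B, sqnorm_le u B.

Definition fin_supp (u : vec) : Prop :=
  exists L : list cfg, forall e, u e <> c0 -> In e L.

Definition conv (s : nat -> vec) (u : vec) : Prop :=
  forall eps, 0 < eps -> exists N, forall n, (N <= n)%nat -> sqnorm_le (vsub (s n) u) eps.

Definition site_eqb (x y : site) : bool :=
  Z.eqb (fst x) (fst y) && Z.eqb (snd x) (snd y).

Definition upd2 (eta : cfg) (x : site) (a : bool) (y : site) (c : bool) : cfg :=
  fun z => if site_eqb z x then a else if site_eqb z y then c else eta z.

Definition shift (x : site) (d : bool) : site :=
  if d then (fst x, (snd x + 1)%Z) else ((fst x + 1)%Z, snd x).

(* coefficients of phi^(lam) = (|01> - lam |10>)/sqrt(1+lam^2),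
   first factor = site x, second = site x+e_j; true = |1> *)
Definition phi_coef (lam : R) (a c : bool) : R :=
  match a, c with
  | false, true => 1 / sqrt (1 + lam ^ 2)
  | true, false => - lam / sqrt (1 + lam ^ 2)
  | _, _ => 0
  end.

(* matrix element <a c| h |a' c'> of h = |phi><phi| + |11><11| *)
Definition hloc (lam : R) (a c a' c' : bool) : R :=
  phi_coef lam a c * phi_coef lam a' c' + (if a && c && a' && c' then 1 else 0).

Definition hb_apply (lam : R) (x y : site) (psi : vec) (eta' : cfg) : cpx :=
  csum (map (fun p : bool * bool =>
               cscale (hloc lam (eta' x) (eta' y) (fst p) (snd p))
                      (psi (upd2 eta' x (fst p) y (snd p))))
            [(false, false); (false, true); (true, false); (true, true)]).

Definition zrange (n : nat) : list Z :=
  map (fun k => (Z.of_nat k - Z.of_nat n)%Z) (seq 0 (2 * n + 1)).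
Definition box_bonds (n : nat) : list (site * bool) :=
  flat_map (fun a => flat_map (fun b => [((a, b), false); ((a, b), true)])
                              (zrange n)) (zrange n).

Definition Hbox (m1 m2 l1 l2 : R) (n : nat) (psi : vec) (eta' : cfg) : cpx :=
  csum (map (fun bd : site * bool =>
               let x := fst bd in let d := snd bd in let y := shift x d in
               if inDb m1 m2 x && inDb m1 m2 y
               then hb_apply (if d then l2 else l1) x y psi eta'
               else c0)
            (box_bonds n)).

(* phi = (sum_j sum_{x,x+e_j in D} h_{x,x+e_j}) psi  (the sum is finite at
   every valid eta', so the box sums are eventually constant) *)
Definition H0 (m1 m2 l1 l2 : R) (psi phi : vec) : Prop :=
  forall eta',
    (valid_cfg m1 m2 eta' ->
       exists N, forall n, (N <= n)%nat -> phi eta' = Hbox m1 m2 l1 l2 n psi eta') /\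
    (~ valid_cfg m1 m2 eta' -> phi eta' = c0).

(* graph of H^D: closure of H0 restricted to finitely supported vectors *)
Definition HD (m1 m2 l1 l2 : R) (psi phi : vec) : Prop :=
  in_l2 m1 m2 psi /\ in_l2 m1 m2 phi /\
  exists (ps ph : nat -> vec),
    (forall n, in_l2 m1 m2 (ps n) /\ fin_supp (ps n) /\ H0 m1 m2 l1 l2 (ps n) (ph n)) /\
    conv ps psi /\ conv ph phi.

Definition resolvent (m1 m2 : R) (G : vec -> vec -> Prop) (mu : R) : Prop :=
  (forall phi, in_l2 m1 m2 phi ->
     exists psi chi, G psi chi /\ vsub chi (vscale mu psi) = phi) /\
  (forall psi1 chi1 psi2 chi2, G psi1 chi1 -> G psi2 chi2 ->
     vsub chi1 (vscale mu psi1) = vsub chi2 (vscale mu psi2) -> psi1 = psi2) /\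
  (exists K, 0 <= K /\ forall psi chi r, G psi chi ->
     sqnorm_le (vsub chi (vscale mu psi)) r -> sqnorm_le psi (K * r)).

Definition in_spec (m1 m2 : R) (G : vec -> vec -> Prop) (mu : R) : Prop :=
  ~ resolvent m1 m2 G mu.

(* gamma(H) > 0, i.e. sup{delta > 0 : spec(H) /\ (0,delta) = empty} > 0 *)
Definition gap_pos (m1 m2 : R) (G : vec -> vec -> Prop) : Prop :=
  exists delta, 0 < delta /\
    forall mu, 0 < mu < delta -> ~ in_spec m1 m2 G mu.

(* Main.v *)
From Stdlib Require Import Reals Lra Lia ZArith List Permutation Bool.
From Stdlib Require Import Classical ClassicalEpsilon FunctionalExtensionality.
Require Import Defs.
Import ListNotations.
Open Scope R_scope.

(* The vacuum is annihilated by H, so it suffices that H is bounded below by a multiple of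
   the particle number on finitely supported vectors without vacuum component.  Let rho(x)
   be the expected number of particles at x.  On the bond (x, x + e_j) either both sites
   are occupied, which costs energy, or a single particle hops with amplitude ratio
   lambda_j up to an error controlled by the energy; hence for every g > 1
     rho(x) <= g lambda_j^(-2) rho(x + e_j) + C <h>,
   and the same with the two sites exchanged and lambda_j inverted.  The hypothesis on
   log lambda says exactly that some v in Z^2 has m . v >= 0 and v . log lambda > 0.
   Chaining the inequality along a staircase from x to x + v inside D and summing over x
   gives N <= q N + C' <H> with q < 1.

   It remains to see that (H - mu) has dense range for 0 < mu < delta: on finitely
   supported vectors with at most M particles and no vacuum component, H is bounded and
   H - mu coercive, so the equation is solved approximately by a contracting iteration.
   The matrix elements of H are real, so H acts on real and imaginary parts separately. *)

(** * Finitely supported sums *)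

(** Classical, since it is applied to reals and to configurations, which are functions on an
    infinite lattice. *)
Definition ceq {T : Type} (x y : T) : {x = y} + {x <> y} :=
  excluded_middle_informative (x = y).

Section ListSums.
Context {T : Type}.
Implicit Types (L : list T) (f g : T -> R).

Lemma rsum_app l l' : rsum (l ++ l') = rsum l + rsum l'.
Proof. induction l as [|a l IH]; simpl; lra. Qed.

Lemma rsum_perm l l' : Permutation l l' -> rsum l = rsum l'.
Proof. induction 1; simpl; lra. Qed.

Lemma rsum_lin a c f g L :
  rsum (map (fun e => a * f e + c * g e) L)
  = a * rsum (map f L) + c * rsum (map g L).
Proof. induction L as [|e L IH]; simpl; [ring | rewrite IH; ring]. Qed.

Lemma rsum_le f g L :
  (forall e, In e L -> f e <= g e) -> rsum (map f L) <= rsum (map g L).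
Proof.
  induction L as [|e L IH]; simpl; intros H; [lra|].
  assert (f e <= g e) by auto. assert (rsum (map f L) <= rsum (map g L)) by auto.
  lra.
Qed.

Lemma rsum_ext f g L :
  (forall e, In e L -> f e = g e) -> rsum (map f L) = rsum (map g L).
Proof. intros H; f_equal; apply map_ext_in; auto. Qed.

Lemma rsum_zero f L : (forall e, In e L -> f e = 0) -> rsum (map f L) = 0.
Proof.
  induction L as [|e L IH]; simpl; intros H; [lra|].
  rewrite IH, (H e) by auto. lra.
Qed.

Lemma rsum_nonneg f L : (forall e, 0 <= f e) -> 0 <= rsum (map f L).
Proof. intros H; induction L as [|e L IH]; simpl; [lra|]. specialize (H e); lra. Qed.

Definition nzb f (e : T) : bool := if ceq (f e) 0 then false else true.

Lemma nzbP f e : nzb f e = true <-> f e <> 0.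
Proof. unfold nzb; destruct (ceq (f e) 0); intuition congruence. Qed.

Lemma rsum_filter_nz f L : rsum (map f (filter (nzb f) L)) = rsum (map f L).
Proof.
  induction L as [|e L IH]; simpl; [reflexivity|].
  unfold nzb at 1; destruct (ceq (f e) 0) as [h|h]; simpl; rewrite IH; lra.
Qed.

(** Discarding the zeros of [f] leaves two duplicate-free lists with the same elements, hence
    permutations of each other. This makes [fsum] independent of the list chosen. *)
Lemma rsum_supp f L L' :
  NoDup L -> NoDup L' ->
  (forall e, f e <> 0 -> In e L) -> (forall e, f e <> 0 -> In e L') ->
  rsum (map f L) = rsum (map f L').
Proof.
  intros n n' s s'.
  rewrite <- (rsum_filter_nz f L), <- (rsum_filter_nz f L').
  apply rsum_perm, Permutation_map, NoDup_Permutation; try now apply NoDup_filter.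
  intros e; rewrite !filter_In, nzbP; firstorder.
Qed.

Lemma rsum_filter b f L :
  rsum (map f (filter b L)) = rsum (map (fun e => if b e then f e else 0) L).
Proof.
  induction L as [|e L IH]; simpl; [reflexivity|].
  destruct (b e); simpl; rewrite IH; lra.
Qed.

Lemma rsum_CS f g L :
  rsum (map (fun e => f e * g e) L) ^ 2
  <= rsum (map (fun e => f e ^ 2) L) * rsum (map (fun e => g e ^ 2) L).
Proof.
  set (A := rsum (map (fun e => f e ^ 2) L)).
  set (B := rsum (map (fun e => g e ^ 2) L)).
  set (C := rsum (map (fun e => f e * g e) L)).
  assert (A0 : 0 <= A) by (apply rsum_nonneg; intros; nra).
  assert (B0 : 0 <= B) by (apply rsum_nonneg; intros; nra).
  assert (H : forall s t, 0 <= s ^ 2 * A + 2 * s * t * C + t ^ 2 * B).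
  { intros s t.
    replace (s ^ 2 * A + 2 * s * t * C + t ^ 2 * B)
      with (rsum (map (fun e => (s * f e + t * g e) ^ 2) L)).
    - apply rsum_nonneg; intros; apply pow2_ge_0.
    - unfold A, B, C. clear. induction L as [|e L IH]; simpl in *; [ring|].
      rewrite IH; ring. }
  (* The discriminant argument without division: evaluation at [s = B], [t = - C] gives
     [0 <= B * (A * B - C ^ 2)]; if [B = 0], evaluation at [s = C], [t = - (A + 1)] forces
     [C = 0]. *)
  destruct (Req_dec B 0) as [h|h].
  - pose proof (H C (- (A + 1))) as h'. rewrite h in *.
    assert (0 <= C ^ 2) by nra. nra.
  - pose proof (H B (- C)). assert (0 <= B * (A * B - C ^ 2)) by nra.
    assert (0 < B) by lra. nra.
Qed.

End ListSums.

Section FiniteSums.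
Context {T : Type}.
Implicit Types (L : list T) (f g : T -> R).

Definition finsupp f : Prop := exists L, forall e, f e <> 0 -> In e L.

(* junk value when [f] is not finitely supported *)
Definition fsum f : R :=
  epsilon (inhabits 0) (fun s => exists L, NoDup L /\
    (forall e, f e <> 0 -> In e L) /\ s = rsum (map f L)).

Lemma fsumE f L :
  NoDup L -> (forall e, f e <> 0 -> In e L) -> fsum f = rsum (map f L).
Proof.
  intros n s. unfold fsum.
  match goal with |- epsilon ?i ?P = _ => pose proof (epsilon_spec i P) as H end.
  destruct H as (L' & n' & s' & E); [exists (rsum (map f L)), L; auto|].
  rewrite E. now apply rsum_supp.
Qed.

Lemma finsupp_list f : finsupp f -> exists L, NoDup L /\ forall e, f e <> 0 -> In e L.
Proof.
  intros [L H]. exists (nodup ceq L). split; [apply NoDup_nodup|].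
  intros e h; apply nodup_In; auto.
Qed.

Lemma finsupp_list2 f g : finsupp f -> finsupp g ->
  exists L, NoDup L /\ (forall e, f e <> 0 -> In e L) /\ (forall e, g e <> 0 -> In e L).
Proof.
  intros [L H] [L' H']. exists (nodup ceq (L ++ L')).
  split; [apply NoDup_nodup|].
  split; intros e h; apply nodup_In, in_or_app; auto.
Qed.

Lemma finsupp_imp f g : finsupp f -> (forall e, g e <> 0 -> f e <> 0) -> finsupp g.
Proof. intros [L H] i. exists L; auto. Qed.

Lemma finsupp_imp2 f f' g : finsupp f -> finsupp f' ->
  (forall e, g e <> 0 -> f e <> 0 \/ f' e <> 0) -> finsupp g.
Proof.
  intros [L H] [L' H'] i. exists (L ++ L'). intros e h. apply in_or_app.
  destruct (i e h); auto.
Qed.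

Lemma fsum_lin a c f g : finsupp f -> finsupp g ->
  fsum (fun e => a * f e + c * g e) = a * fsum f + c * fsum g.
Proof.
  intros hf hg. destruct (finsupp_list2 f g hf hg) as (L & n & s & s').
  rewrite (fsumE f L), (fsumE g L), (fsumE _ L), rsum_lin; auto.
  intros e h. destruct (classic (f e = 0)) as [z|z]; [|auto].
  apply s'. intros z'. apply h. rewrite z, z'. ring.
Qed.

Lemma fsum_scal a f : finsupp f -> fsum (fun e => a * f e) = a * fsum f.
Proof.
  intros hf. transitivity (fsum (fun e => a * f e + 0 * f e)).
  - f_equal; extensionality e; ring.
  - rewrite fsum_lin; auto; ring.
Qed.

Lemma fsum_plus f g : finsupp f -> finsupp g -> fsum (fun e => f e + g e) = fsum f + fsum g.
Proof.
  intros hf hg. transitivity (fsum (fun e => 1 * f e + 1 * g e)).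
  - f_equal; extensionality e; ring.
  - rewrite fsum_lin; auto; ring.
Qed.

Lemma fsum_le f g : finsupp f -> finsupp g -> (forall e, f e <= g e) -> fsum f <= fsum g.
Proof.
  intros hf hg H. destruct (finsupp_list2 f g hf hg) as (L & n & s & s').
  rewrite (fsumE f L), (fsumE g L); auto. apply rsum_le; auto.
Qed.

Lemma fsum_0 f : (forall e, f e = 0) -> fsum f = 0.
Proof.
  intros H. rewrite (fsumE f []); [reflexivity|constructor|].
  intros e h; now elim h.
Qed.

Lemma fsum_nz f : fsum f <> 0 -> exists e, f e <> 0.
Proof.
  intros H. apply NNPP; intros h. apply H, fsum_0.
  intros e. apply NNPP; intros h'. apply h; now exists e.
Qed.

Lemma fsum_nonneg f : finsupp f -> (forall e, 0 <= f e) -> 0 <= fsum f.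
Proof.
  intros hf H. destruct (finsupp_list f hf) as (L & n & s).
  rewrite (fsumE f L); auto. now apply rsum_nonneg.
Qed.

(** [L] is completed by the support points that it misses, and these add nonnegative terms. *)
Lemma rsum_le_fsum f L : finsupp f -> NoDup L -> (forall e, 0 <= f e) ->
  rsum (map f L) <= fsum f.
Proof.
  intros hf n H. destruct (finsupp_list f hf) as (L' & n' & s).
  set (M := filter (fun e => if in_dec ceq e L then false else true) L').
  rewrite (fsumE f (L ++ M)).
  - rewrite map_app, rsum_app. pose proof (rsum_nonneg f M H). lra.
  - apply NoDup_app; [auto|now apply NoDup_filter|].
    intros e h. unfold M. rewrite filter_In. destruct (in_dec ceq e L); intuition congruence.
  - intros e h. apply in_or_app. unfold M; rewrite filter_In.
    destruct (in_dec ceq e L); auto.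
Qed.

Lemma finsupp_comp f (s s' : T -> T) :
  (forall e, s' (s e) = e) -> finsupp f -> finsupp (fun e => f (s e)).
Proof.
  intros i [L H]. exists (map s' L). intros e h.
  rewrite <- (i e). apply in_map; auto.
Qed.

Lemma fsum_comp f (s s' : T -> T) :
  (forall e, s' (s e) = e) -> (forall e, s (s' e) = e) -> finsupp f ->
  fsum (fun e => f (s e)) = fsum f.
Proof.
  intros i i' hf. destruct (finsupp_list f hf) as (L & n & sp).
  rewrite (fsumE f L), (fsumE _ (map s' L)); auto.
  - rewrite map_map. apply rsum_ext. intros e _. now rewrite i'.
  - apply FinFun.Injective_map_NoDup; auto.
    intros x y h. rewrite <- (i' x), <- (i' y). now f_equal.
  - intros e h. rewrite <- (i e). apply in_map; auto.
Qed.

(** The involution pairs the terms: twice the sum of [f] is the sum of [f e + f (s e)]. It is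
    applied to the exchange of the two sites of a bond, where only the paired terms have a definite
    sign. *)
Lemma fsum_sym_nonneg f (s : T -> T) :
  (forall e, s (s e) = e) -> finsupp f -> (forall e, 0 <= f e + f (s e)) -> 0 <= fsum f.
Proof.
  intros i hf H. pose proof (finsupp_comp f s s i hf) as hf'.
  assert (E : fsum (fun e => f e + f (s e)) = 2 * fsum f).
  { rewrite fsum_plus, (fsum_comp f s s); auto; ring. }
  assert (0 <= fsum (fun e => f e + f (s e))); [|lra].
  apply fsum_nonneg; auto.
  apply (finsupp_imp2 f (fun e => f (s e))); auto.
  intros e h. destruct (classic (f e = 0)) as [z|z]; auto.
  right; intros z'; apply h; rewrite z, z'; ring.
Qed.

Lemma fsum_single f x : (forall e, f e <> 0 -> e = x) -> fsum f = f x.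
Proof.
  intros H. rewrite (fsumE f [x]); simpl; [ring| |].
  - constructor; [easy|constructor].
  - intros e h; left; symmetry; auto.
Qed.

End FiniteSums.

(** * Exchange of finite double sums *)

Lemma rsum_exchange {A B : Type} (F : A -> B -> R) (L : list A) (M : list B) :
  rsum (map (fun a => rsum (map (F a) M)) L)
  = rsum (map (fun b => rsum (map (fun a => F a b) L)) M).
Proof.
  induction L as [|a L IH]; simpl.
  - symmetry; apply rsum_zero; auto.
  - rewrite IH. clear. induction M as [|b M IH]; simpl in *; [ring|].
    rewrite <- IH; ring.
Qed.

Section Exchange.
Context {A B : Type} (F : A -> B -> R) (L : list A) (M : list B).
Hypothesis supp : forall a b, F a b <> 0 -> In a L /\ In b M.

Lemma finsupp_row a : finsupp (F a).
Proof. exists M; intros b h; now apply supp in h. Qed.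

Lemma finsupp_row_sum : finsupp (fun a => fsum (F a)).
Proof. exists L; intros a h. apply fsum_nz in h as [b h]. now apply supp in h. Qed.

Lemma fsum_exchange :
  fsum (fun a => fsum (F a)) = fsum (fun b => fsum (fun a => F a b)).
Proof.
  set (L' := nodup ceq L). set (M' := nodup ceq M).
  assert (nL : NoDup L') by apply NoDup_nodup.
  assert (nM : NoDup M') by apply NoDup_nodup.
  assert (s : forall a b, F a b <> 0 -> In a L' /\ In b M').
  { intros a b h. apply supp in h. unfold L', M'. now rewrite !nodup_In. }
  rewrite (fsumE _ L'), (fsumE _ M'); auto.
  - rewrite (rsum_ext (fun a => fsum (F a)) (fun a => rsum (map (F a) M'))).
    + rewrite rsum_exchange. apply rsum_ext. intros b _. symmetry. apply fsumE; auto.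
      intros a h; now apply s in h.
    + intros a _. apply fsumE; auto. intros b h; now apply s in h.
  - intros b h. apply fsum_nz in h as [a h]. now apply s in h.
  - intros a h. apply fsum_nz in h as [b h]. now apply s in h.
Qed.
End Exchange.

(** * The Hamiltonian on real functions of configurations *)

Lemma site_eqbP x y : reflect (x = y) (site_eqb x y).
Proof.
  unfold site_eqb. destruct x as [a b], y as [c d]; simpl.
  destruct (Z.eqb_spec a c), (Z.eqb_spec b d); simpl; constructor; congruence.
Qed.

Definition swap (x y : site) (eta : cfg) : cfg :=
  fun z => if site_eqb z x then eta y else if site_eqb z y then eta x else eta z.

Ltac case_sites :=
  repeat match goal with
  | |- context [site_eqb ?a ?b] => destruct (site_eqbP a b); subst; try congruence
  end.

Lemma swap_l x y eta : swap x y eta x = eta y.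
Proof. unfold swap; case_sites. Qed.

Lemma swap_r x y eta : swap x y eta y = eta x.
Proof. unfold swap; case_sites. Qed.

Lemma swapK x y eta : swap x y (swap x y eta) = eta.
Proof. extensionality z. unfold swap; case_sites; reflexivity. Qed.

Lemma upd2_id x y eta : upd2 eta x (eta x) y (eta y) = eta.
Proof. extensionality z. unfold upd2; case_sites; reflexivity. Qed.

Lemma upd2_swapped x y eta : upd2 eta x (eta y) y (eta x) = swap x y eta.
Proof. extensionality z. unfold upd2, swap; case_sites; reflexivity. Qed.

(** The entries of [|phi><phi| + |11><11|] written out. This matrix conserves the particle number of
    the bond, so only [eta] and its exchange occur. *)
Definition bond_op (lam : R) (x y : site) (f : cfg -> R) (eta : cfg) : R :=
  match eta x, eta y with
  | false, false => 0
  | false, true => (f eta - lam * f (swap x y eta)) / (1 + lam ^ 2)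
  | true, false => lam * (lam * f eta - f (swap x y eta)) / (1 + lam ^ 2)
  | true, true => f eta
  end.

Definition re (u : vec) : cfg -> R := fun e => fst (u e).
Definition im (u : vec) : cfg -> R := fun e => snd (u e).

(** Among the four updated configurations, only those with as many particles on the bond as [eta]
    have a nonzero coefficient, and these are [eta] and its exchange. The coefficients are real, so
    the real and imaginary parts separate. *)
Lemma hb_apply_bond_op lam x y psi eta :
  hb_apply lam x y psi eta = (bond_op lam x y (re psi) eta, bond_op lam x y (im psi) eta).
Proof.
  assert (P : 0 < 1 + lam ^ 2) by nra.
  pose proof (sqrt_sqrt (1 + lam ^ 2) (Rlt_le _ _ P)) as S.
  pose proof (sqrt_lt_R0 _ P) as S0.
  pose proof (upd2_id x y eta) as U. pose proof (upd2_swapped x y eta) as V.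
  unfold hb_apply, bond_op, hloc, phi_coef, csum, cadd, cscale, re, im; simpl map.
  destruct (eta x), (eta y); simpl; rewrite ?U, ?V;
    simpl in S, S0, P; set (s := sqrt _) in *; f_equal; rewrite <- ?S; field; lra.
Qed.

Definition bond : Type := (site * bool)%type.
Definition src (b : bond) : site := fst b.
Definition tgt (b : bond) : site := shift (fst b) (snd b).
Definition bswap (b : bond) : cfg -> cfg := swap (src b) (tgt b).
Definition touch (b : bond) (eta : cfg) : bool := (eta (src b) || eta (tgt b))%bool.

Definition unshift (x : site) (d : bool) : site :=
  if d then (fst x, (snd x - 1)%Z) else ((fst x - 1)%Z, snd x).

Lemma shiftK x d : unshift (shift x d) d = x.
Proof. destruct x, d; unfold shift, unshift; simpl; f_equal; lia. Qed.

Lemma unshiftK x d : shift (unshift x d) d = x.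
Proof. destruct x, d; unfold shift, unshift; simpl; f_equal; lia. Qed.

Lemma touch_bswap b eta : touch b (bswap b eta) = touch b eta.
Proof. unfold touch, bswap. rewrite swap_l, swap_r. apply orb_comm. Qed.

Definition finite_cfg (eta : cfg) : Prop :=
  exists l : list site, forall x, eta x = true -> In x l.

Definition bonds_at (x : site) : list bond :=
  [(x, false); (x, true); (unshift x false, false); (unshift x true, true)].

Lemma touch_bonds eta l b : (forall x, eta x = true -> In x l) ->
  touch b eta = true -> In b (flat_map bonds_at l).
Proof.
  intros H h. destruct b as [x d]. unfold touch, src, tgt in h; simpl in h.
  apply in_flat_map. apply orb_prop in h as [h|h]; apply H in h.
  - exists x; split; auto. destruct d; simpl; auto.
  - exists (shift x d); split; auto. rewrite <- (shiftK x d) at 1.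
    destruct d; simpl; auto.
Qed.

(** Each site lies on four bonds, so finitely many particles meet finitely many bonds. This turns
    the Hamiltonian into a finite sum on [core]. *)
Lemma touch_finite_list (L : list cfg) : (forall eta, In eta L -> finite_cfg eta) ->
  exists B, forall b eta, In eta L -> touch b eta = true -> In b B.
Proof.
  induction L as [|e L IH]; intros H; [exists []; easy|].
  destruct IH as [B h]; [intros; apply H; now right|].
  destruct (H e) as [l h']; [now left|].
  exists (B ++ flat_map bonds_at l). intros b eta [->|i] t;
    apply in_or_app; eauto using touch_bonds.
Qed.

Section Hamiltonian.
Context (D : site -> bool) (lam : bool -> R).

Definition bond_term (b : bond) (f : cfg -> R) (eta : cfg) : R :=
  if D (src b) && D (tgt b) then bond_op (lam (snd b)) (src b) (tgt b) f eta else 0.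

Definition ham (f : cfg -> R) (eta : cfg) : R := fsum (fun b => bond_term b f eta).

Definition valid_supp (f : cfg -> R) : Prop :=
  forall eta, f eta <> 0 -> finite_cfg eta /\ forall x, eta x = true -> D x = true.

(** The real and imaginary parts of the vectors on which the Hamiltonian is first defined, before
    taking the closure. *)
Definition core (f : cfg -> R) : Prop := finsupp f /\ valid_supp f.

Lemma bond_term_lin a c b f g eta :
  bond_term b (fun e => a * f e + c * g e) eta = a * bond_term b f eta + c * bond_term b g eta.
Proof.
  unfold bond_term, bond_op. destruct (D _ && D _); [|ring].
  assert (0 < 1 + lam (snd b) ^ 2) by nra.
  destruct (eta _), (eta _); field; lra.
Qed.

Lemma bond_term_nz b f eta : bond_term b f eta <> 0 ->
  D (src b) = true /\ D (tgt b) = true /\ touch b eta = true /\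
  (f eta <> 0 \/ f (bswap b eta) <> 0).
Proof.
  unfold bond_term, bond_op, touch. intros H.
  destruct (D (src b)), (D (tgt b)); simpl in H; try (now elim H).
  do 2 (split; [reflexivity|]).
  split; [destruct (eta _), (eta _); auto|].
  destruct (classic (f eta = 0)) as [z|z]; auto. right; intros z'. apply H.
  unfold bswap in z'. rewrite z, z'. unfold Rdiv; destruct (eta _), (eta _); ring.
Qed.

(** The configurations are the support of [f] together with its images under exchanges along the
    finitely many bonds that touch it. The support is bounded by a product, as [fsum_exchange]
    requires. *)
Lemma bond_term_supp f : core f ->
  exists L B, forall eta b, bond_term b f eta <> 0 -> In eta L /\ In b B.
Proof.
  intros [[L0 H] V]. set (L1 := filter (nzb f) L0).
  assert (H1 : forall e, f e <> 0 -> In e L1).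
  { intros e h. apply filter_In. split; auto. now apply nzbP. }
  destruct (touch_finite_list L1) as [B h].
  { intros e i. apply filter_In in i as [_ i]. apply nzbP in i. now apply V. }
  exists (L1 ++ flat_map (fun b => map (bswap b) L1) B), B.
  intros eta b t. apply bond_term_nz in t as (_ & _ & t & [z|z]); apply H1 in z.
  - split; [apply in_or_app; auto|eauto].
  - assert (i : In b B) by (apply (h b _ z); now rewrite touch_bswap).
    split; auto. apply in_or_app; right. apply in_flat_map. exists b; split; auto.
    rewrite <- (swapK (src b) (tgt b) eta). now apply (in_map (bswap b)).
Qed.

Lemma finsupp_tb f eta : core f -> finsupp (fun b => bond_term b f eta).
Proof.
  intros H. destruct (bond_term_supp f H) as (L & B & s). exists B. intros b h.
  now apply s in h.
Qed.

Lemma core_lin a c f g : core f -> core g -> core (fun e => a * f e + c * g e).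
Proof.
  intros [hf vf] [hg vg].
  assert (N : forall e, a * f e + c * g e <> 0 -> f e <> 0 \/ g e <> 0).
  { intros e h. destruct (classic (f e = 0)) as [z|z]; auto.
    right; intros z'; apply h; rewrite z, z'; ring. }
  split; [now apply (finsupp_imp2 f g)|]. intros e h. destruct (N e h); auto.
Qed.

Lemma ham_lin a c f g : core f -> core g ->
  ham (fun e => a * f e + c * g e) = fun e => a * ham f e + c * ham g e.
Proof.
  intros hf hg. extensionality eta. unfold ham.
  rewrite <- fsum_lin by now apply finsupp_tb.
  f_equal; extensionality b; apply bond_term_lin.
Qed.

Lemma ham_nz f eta : ham f eta <> 0 ->
  exists b, D (src b) = true /\ D (tgt b) = true /\ touch b eta = true /\
  (f eta <> 0 \/ f (bswap b eta) <> 0).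
Proof. intros h; apply fsum_nz in h as [b h]. exists b; now apply bond_term_nz in h. Qed.

Lemma core_ham f : core f -> core (ham f).
Proof.
  intros H. split.
  - destruct (bond_term_supp f H) as (L & B & s). now apply (finsupp_row_sum _ L B).
  - intros eta h. apply ham_nz in h as (b & d & d' & _ & [z|z]); [now apply H|].
    apply (proj2 H) in z as [[l z] z'].
    assert (E : forall x, eta x = true -> x = src b \/ x = tgt b \/ bswap b eta x = true).
    { intros x e. unfold bswap, swap. case_sites; auto. }
    split.
    + exists (src b :: tgt b :: l). intros x e. simpl.
      destruct (E x e) as [->|[->|e']]; auto.
    + intros x e. destruct (E x e) as [->|[->|e']]; auto.
Qed.

Definition vac : cfg := fun _ => false.

Lemma ham_vac f : ham f vac = 0.
Proof.
  apply NNPP; intros h. apply ham_nz in h as (b & _ & _ & h & _). discriminate.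
Qed.

Definition dvac : cfg -> R := fun e => if ceq e vac then 1 else 0.

Lemma core_dvac : core dvac.
Proof.
  unfold dvac; split.
  - exists [vac]. intros e. destruct (ceq e vac) as [->|]; simpl; [auto|congruence].
  - intros e. destruct (ceq e vac) as [->|]; [|congruence].
    intros _. split; [exists []|]; discriminate.
Qed.

(** No bond touches the vacuum, and an exchange cannot turn a touched configuration into the
    vacuum. *)
Lemma ham_dvac : ham dvac = fun _ => 0.
Proof.
  extensionality eta. apply NNPP; intros h.
  apply ham_nz in h as (b & _ & _ & h & [z|z]); revert z; unfold dvac;
    destruct (ceq _ vac) as [E|]; try congruence; intros _.
  - rewrite E in h; discriminate.
  - rewrite <- touch_bswap, E in h; discriminate.
Qed.

End Hamiltonian.

(** * Energy and particle density *)

Lemma finsupp_mul_l {T : Type} (f g : T -> R) : finsupp f -> finsupp (fun e => f e * g e).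
Proof. intros H. apply (finsupp_imp f); auto. intros e h z; apply h; rewrite z; ring. Qed.

Lemma finsupp_mul_r {T : Type} (f g : T -> R) : finsupp g -> finsupp (fun e => f e * g e).
Proof. intros H. apply (finsupp_imp g); auto. intros e h z; apply h; rewrite z; ring. Qed.

Lemma finsupp_sq {T : Type} (f : T -> R) : finsupp f -> finsupp (fun e => f e ^ 2).
Proof. intros H. apply (finsupp_imp f); auto. intros e h z; apply h; rewrite z; ring. Qed.

Lemma finsupp_lin {T : Type} (a c : R) (f g : T -> R) :
  finsupp f -> finsupp g -> finsupp (fun e => a * f e + c * g e).
Proof.
  intros hf hg. apply (finsupp_imp2 f g); auto. intros e h.
  destruct (classic (f e = 0)) as [z|z]; auto.
  right; intros z'; apply h; rewrite z, z'; ring.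
Qed.

(** The left inverse makes [s] injective, so the sum on the left runs over distinct terms of the sum
    of [f]. It serves to bound the energies of one bond per site by the total energy. *)
Lemma fsum_inj_le {T U : Type} (f : U -> R) (s : T -> U) (p : U -> T) :
  (forall x, p (s x) = x) -> finsupp f -> (forall e, 0 <= f e) ->
  finsupp (fun x => f (s x)) /\ fsum (fun x => f (s x)) <= fsum f.
Proof.
  intros i hf P.
  assert (h : finsupp (fun x => f (s x))).
  { destruct hf as [L H]. exists (map p L). intros x h. rewrite <- (i x).
    apply in_map; auto. }
  split; auto. destruct (finsupp_list _ h) as (L & n & sp).
  rewrite (fsumE _ L), <- (map_map s f) by auto.
  apply rsum_le_fsum; auto. apply FinFun.Injective_map_NoDup; auto.
  intros x y E. rewrite <- (i x), <- (i y). now f_equal.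
Qed.

Definition b2r (b : bool) : R := if b then 1 else 0.

Definition sadd (x w : site) : site := ((fst x + fst w)%Z, (snd x + snd w)%Z).
Definition sopp (w : site) : site := ((- fst w)%Z, (- snd w)%Z).

Lemma saddK x w : sadd (sadd x w) (sopp w) = x.
Proof. destruct x, w; unfold sadd, sopp; simpl; f_equal; lia. Qed.

Lemma saddK' x w : sadd (sadd x (sopp w)) w = x.
Proof. destruct x, w; unfold sadd, sopp; simpl; f_equal; lia. Qed.

Definition sq (f : cfg -> R) : R := fsum (fun eta => f eta ^ 2).

Lemma finsupp_nonvac f : finsupp f -> finsupp (fun eta => if ceq eta vac then 0 else f eta ^ 2).
Proof.
  intros H; apply (finsupp_imp _ _ H). intros e h z; apply h.
  destruct (ceq e vac); [reflexivity|rewrite z; ring].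
Qed.

Lemma sq_vac f : finsupp f ->
  sq f = fsum (fun eta => if ceq eta vac then 0 else f eta ^ 2) + f vac ^ 2.
Proof.
  intros H. unfold sq.
  assert (E : fsum (fun eta => if ceq eta vac then f eta ^ 2 else 0) = f vac ^ 2).
  { rewrite (fsum_single _ vac); [destruct (ceq vac vac); congruence|].
    intros e h. destruct (ceq e vac); congruence. }
  rewrite <- E, <- fsum_plus.
  - f_equal; extensionality e; destruct (ceq e vac); ring.
  - now apply finsupp_nonvac.
  - apply (finsupp_imp _ _ H). intros e h z; apply h.
    destruct (ceq e vac); [rewrite z; ring|reflexivity].
Qed.

Section Energy.
Context (D : site -> bool) (lam : bool -> R).
Hypothesis lam_pos : forall d, 0 < lam d.
Notation tb := (bond_term D lam).
Notation Hop := (ham D lam).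
Notation coreD := (core D).

Implicit Types (f : cfg -> R) (b : bond).

Definition rho (f : cfg -> R) (x : site) : R := fsum (fun eta => b2r (eta x) * f eta ^ 2).
Definition bond_energy (f : cfg -> R) (b : bond) : R := fsum (fun eta => f eta * tb b f eta).
Definition energy_form (f : cfg -> R) : R := fsum (fun eta => f eta * Hop f eta).

Lemma finsupp_rho_term f x : finsupp f -> finsupp (fun eta => b2r (eta x) * f eta ^ 2).
Proof. intros H; now apply finsupp_mul_r, finsupp_sq. Qed.

Lemma rho_nonneg f x : finsupp f -> 0 <= rho f x.
Proof.
  intros H. apply fsum_nonneg; [now apply finsupp_rho_term|].
  intros e; unfold b2r; destruct (e x); nra.
Qed.

Lemma rho_nz f x : rho f x <> 0 -> exists eta, eta x = true /\ f eta <> 0.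
Proof.
  intros h; apply fsum_nz in h as [e h]. exists e. unfold b2r in h.
  destruct (e x); [split; auto; intros z; apply h; rewrite z; ring|].
  elim h; ring.
Qed.

Lemma sites_finite f : coreD f ->
  exists S, forall eta x, f eta <> 0 -> eta x = true -> In x S.
Proof.
  intros [[L H] V]. revert f H V.
  induction L as [|a L IH]; intros f H V.
  - exists []. intros e x h. elim (H e h).
  - destruct (IH (fun e => if ceq e a then 0 else f e)) as [S h].
    + intros e h. destruct (ceq e a); [congruence|].
      destruct (H e h); [congruence|auto].
    + intros e h. destruct (ceq e a); [congruence|auto].
    + destruct (classic (f a = 0)) as [z|z].
      * exists S. intros e x i. apply h. destruct (ceq e a); congruence.
      * destruct (V a z) as [[l hl] _]. exists (l ++ S).
        intros e x i j. apply in_or_app. destruct (ceq e a) as [->|n]; auto.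
        right; apply (h e); auto. destruct (ceq e a); congruence.
Qed.

Lemma finsupp_rho f : coreD f -> finsupp (rho f).
Proof.
  intros H. destruct (sites_finite f H) as [S h]. exists S. intros x r.
  apply rho_nz in r as (e & i & j). eauto.
Qed.

Lemma rho_outside f x : coreD f -> D x = false -> rho f x = 0.
Proof.
  intros H d. apply NNPP; intros h. apply rho_nz in h as (e & i & j).
  apply (proj2 H) in j as [_ j]. apply j in i. congruence.
Qed.

(** After exchanging the sums, the right side weighs [f eta ^ 2] by the number of particles of
    [eta], which is at least one off the vacuum. *)
Lemma nonvac_le_rho f : coreD f ->
  fsum (fun eta => if ceq eta vac then 0 else f eta ^ 2) <= fsum (rho f).
Proof.
  intros H. destruct (sites_finite f H) as [S h]. destruct (proj1 H) as [L l].
  assert (s : forall eta x, b2r (eta x) * f eta ^ 2 <> 0 -> In eta L /\ In x S).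
  { intros e x i. unfold b2r in i. destruct (e x) eqn:E; [|elim i; ring].
    assert (f e <> 0) by (intros z; apply i; rewrite z; ring). eauto. }
  unfold rho. rewrite <- (fsum_exchange (fun eta x => b2r (eta x) * f eta ^ 2) L S s).
  apply fsum_le.
  - apply finsupp_nonvac, H.
  - exact (finsupp_row_sum _ L S s).
  - intros eta.
    assert (P : forall x, 0 <= b2r (eta x) * f eta ^ 2)
      by (intros x; unfold b2r; destruct (eta x); nra).
    pose proof (finsupp_row _ L S s eta) as F.
    destruct (ceq eta vac) as [->|n]; [now apply fsum_nonneg|].
    destruct (classic (exists x, eta x = true)) as [[x e]|e].
    + assert (N : NoDup [x]) by (constructor; [easy|constructor]).
      pose proof (rsum_le_fsum _ [x] F N P) as Q. simpl in Q.
      rewrite e in Q. unfold b2r at 1 in Q. simpl. lra.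
    + elim n. extensionality x. unfold vac.
      destruct (eta x) eqn:E; [elim e; eauto|reflexivity].
Qed.

Lemma finsupp_en_term f b : finsupp f -> finsupp (fun eta => f eta * tb b f eta).
Proof. intros H; now apply finsupp_mul_l. Qed.

Lemma energy_split f : coreD f -> finsupp (bond_energy f) /\ energy_form f = fsum (bond_energy f).
Proof.
  intros H. destruct (bond_term_supp D lam f H) as (L & B & s).
  assert (s' : forall eta b, f eta * tb b f eta <> 0 -> In eta L /\ In b B).
  { intros e b h. apply s. intros z; apply h; rewrite z; ring. }
  split.
  - exists B. intros b h. apply fsum_nz in h as [e h]. now apply s' in h.
  - unfold energy_form, bond_energy. rewrite <- (fsum_exchange _ L B s').
    f_equal; extensionality e. symmetry; apply fsum_scal. now apply finsupp_tb.
Qed.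

Lemma bswap_src b eta : bswap b eta (src b) = eta (tgt b).
Proof. apply swap_l. Qed.
Lemma bswap_tgt b eta : bswap b eta (tgt b) = eta (src b).
Proof. apply swap_r. Qed.
Lemma bswapK b eta : bswap b (bswap b eta) = eta.
Proof. apply swapK. Qed.

Lemma bond_termE b f eta : D (src b) = true -> D (tgt b) = true ->
  tb b f eta = match eta (src b), eta (tgt b) with
  | false, false => 0
  | false, true => (f eta - lam (snd b) * f (bswap b eta)) / (1 + lam (snd b) ^ 2)
  | true, false =>
      lam (snd b) * (lam (snd b) * f eta - f (bswap b eta)) / (1 + lam (snd b) ^ 2)
  | true, true => f eta
  end.
Proof. intros d d'. unfold bond_term. now rewrite d, d'. Qed.

(** Reduces an inequality between densities and bond energy to one about two amplitudes. Pairing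
    [eta] with its exchange, let [q] and [p] be the amplitudes with the particle at the target and
    at the source: the pair has energy [(q - lam p) ^ 2 / (1 + lam ^ 2)], which gives the quadratic
    condition. The condition [0 <= A' + A + C] handles doubly occupied bonds. *)
Lemma bond_density f b A A' C : finsupp f -> D (src b) = true -> D (tgt b) = true ->
  0 <= A' + A + C ->
  (forall p q, 0 <= A * q ^ 2 + A' * p ^ 2
     + C * ((q - lam (snd b) * p) ^ 2 / (1 + lam (snd b) ^ 2))) ->
  0 <= A * rho f (tgt b) + A' * rho f (src b) + C * bond_energy f b.
Proof.
  intros hf d d' c1 c2. unfold rho, bond_energy.
  pose proof (finsupp_rho_term f (tgt b) hf) as h1.
  pose proof (finsupp_rho_term f (src b) hf) as h2.
  pose proof (finsupp_en_term f b hf) as h3.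
  pose proof (finsupp_lin A A' _ _ h1 h2) as h12.
  pose proof (fsum_lin A A' _ _ h1 h2) as e12.
  pose proof (fsum_lin 1 C _ _ h12 h3) as e. rewrite Rmult_1_l, e12 in e.
  refine (eq_ind _ (fun r => 0 <= r) _ _ e).
  apply (fsum_sym_nonneg _ (bswap b) (bswapK b)); [now apply finsupp_lin|].
  intros eta. rewrite !bond_termE, bswapK, bswap_src, bswap_tgt by auto.
  set (l := lam (snd b)) in *. set (p := f eta). set (q := f (bswap b eta)).
  assert (P : 0 < 1 + l ^ 2) by nra.
  destruct (eta (src b)), (eta (tgt b)); unfold b2r.
  - nra.
  - specialize (c2 p q). apply (Rle_trans _ _ _ c2). right; field; lra.
  - specialize (c2 q p). apply (Rle_trans _ _ _ c2). right; field; lra.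
  - lra.
Qed.

Lemma bond_term_outside b f eta : (D (src b) && D (tgt b))%bool = false -> tb b f eta = 0.
Proof. intros h; unfold bond_term; now rewrite h. Qed.

Lemma en_nonneg f b : finsupp f -> 0 <= bond_energy f b.
Proof.
  intros hf. destruct (D (src b) && D (tgt b))%bool eqn:E.
  - apply andb_prop in E as [d d'].
    pose proof (bond_density f b 0 0 1 hf d d') as H.
    rewrite !Rmult_0_l, !Rplus_0_l, Rmult_1_l in H. apply H; [lra|].
    intros p q. set (l := lam _). rewrite !Rmult_0_l, !Rplus_0_l, Rmult_1_l.
    apply Rmult_le_pos; [apply pow2_ge_0|].
    left; apply Rinv_0_lt_compat; nra.
  - unfold bond_energy. rewrite fsum_0; [lra|]. intros e; rewrite bond_term_outside; auto; ring.
Qed.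

Lemma energy_nonneg f : coreD f -> 0 <= energy_form f.
Proof.
  intros H. destruct (energy_split f H) as [h ->].
  apply fsum_nonneg; auto. intros b; apply en_nonneg, H.
Qed.

(** The difference of the two sides is a perfect square over [g - 1]. The leading factor [g] may be
    taken close to 1, which matters because it is raised to the length of a staircase. *)
Lemma young g q r : 1 < g -> (q - r) ^ 2 <= g * q ^ 2 + g / (g - 1) * r ^ 2.
Proof.
  intros h. assert (E : g * q ^ 2 + g / (g - 1) * r ^ 2 - (q - r) ^ 2
    = ((g - 1) * q + r) ^ 2 / (g - 1)) by (field; lra).
  assert (0 <= ((g - 1) * q + r) ^ 2 / (g - 1)); [|lra].
  apply Rmult_le_pos; [apply pow2_ge_0|]. left; apply Rinv_0_lt_compat; lra.
Qed.

(** On a pair of amplitudes, [r = q - l * p] measures the deviation from the ground state ratio and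
    [r ^ 2 / (1 + l ^ 2)] is the energy. Solving for [p], respectively for [q], and applying Young's
    inequality gives the two bounds. *)
Lemma bond_density_bounds g d : 1 < g -> exists C, 0 <= C /\ forall f x, finsupp f ->
  D x = true -> D (shift x d) = true ->
  rho f x <= g * / lam d ^ 2 * rho f (shift x d) + C * bond_energy f (x, d) /\
  rho f (shift x d) <= g * lam d ^ 2 * rho f x + C * bond_energy f (x, d).
Proof.
  intros hg. specialize (lam_pos d). set (l := lam d) in *.
  assert (K1 : 1 < g / (g - 1)).
  { apply (Rmult_lt_reg_r (g - 1)); [lra|]. unfold Rdiv.
    rewrite Rmult_assoc, Rinv_l; lra. }
  assert (l2 : 0 < l ^ 2) by nra. assert (i2 : 0 < / l ^ 2) by now apply Rinv_0_lt_compat.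
  set (k := g / (g - 1)) in *.
  assert (Y : forall q r, (q - r) ^ 2 <= g * q ^ 2 + k * r ^ 2) by (intros; now apply young).
  (* Large enough for both directions, which require [k * (1 + l ^ 2) / l ^ 2] and
     [k * (1 + l ^ 2)]. Since [k > 1], also [C > 1], which absorbs the coefficient -1 on doubly
     occupied bonds. *)
  set (C := k * (1 + l ^ 2) * (1 + / l ^ 2)).
  assert (C1 : k * (1 + l ^ 2) * 1 <= C).
  { unfold C. apply Rmult_le_compat_l; [nra|lra]. }
  assert (C2 : k * (1 + l ^ 2) * / l ^ 2 <= C).
  { unfold C. apply Rmult_le_compat_l; [nra|lra]. }
  exists C. split; [nra|]. intros f x hf d1 d2. split.
  - assert (0 <= g * / l ^ 2 * rho f (shift x d) + -1 * rho f x + C * bond_energy f (x, d));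
      [|lra].
    apply (bond_density f (x, d)); auto; fold l; [nra|].
    intros p q. cbn [snd]. fold l.
    pose proof (Y q (q - l * p)) as y. set (r := q - l * p) in *.
    assert (P : p ^ 2 = (q - r) ^ 2 * / l ^ 2) by (unfold r; field; lra).
    assert (Q : k * r ^ 2 * / l ^ 2 <= C * (r ^ 2 / (1 + l ^ 2))).
    { apply (Rle_trans _ (k * (1 + l ^ 2) * / l ^ 2 * (r ^ 2 / (1 + l ^ 2)))).
      - right; field; split; nra.
      - apply Rmult_le_compat_r; auto. apply Rmult_le_pos; [apply pow2_ge_0|].
        left; apply Rinv_0_lt_compat; nra. }
    apply (Rmult_le_compat_r (/ l ^ 2)) in y; [|lra]. rewrite <- P in y. lra.
  - assert (0 <= -1 * rho f (shift x d) + g * l ^ 2 * rho f x + C * bond_energy f (x, d)); [|lra].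
    apply (bond_density f (x, d)); auto; fold l; [nra|].
    intros p q. cbn [snd]. fold l.
    pose proof (Y (l * p) (l * p - q)) as y.
    set (r := q - l * p) in *.
    assert (Q : k * r ^ 2 <= C * (r ^ 2 / (1 + l ^ 2))).
    { apply (Rle_trans _ (k * (1 + l ^ 2) * 1 * (r ^ 2 / (1 + l ^ 2)))).
      - right; field; nra.
      - apply Rmult_le_compat_r; auto. apply Rmult_le_pos; [apply pow2_ge_0|].
        left; apply Rinv_0_lt_compat; nra. }
    replace (l * p - (l * p - q)) with q in y by ring.
    replace ((l * p - q) ^ 2) with (r ^ 2) in y by (unfold r; ring). nra.
Qed.

End Energy.

(** * Staircases and the form bound *)

(** One leg of a staircase: [k] steps along the axis [d] ([true] is the second one), forwards if
    [sg] and backwards otherwise. *)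
Definition mulv (k : nat) (d sg : bool) : site :=
  let z := if sg then Z.of_nat k else (- Z.of_nat k)%Z in
  if d then (0%Z, z) else (z, 0%Z).

Lemma sadd_step w k d (sg : bool) :
  sadd w (mulv (S k) d sg)
  = if sg then shift (sadd w (mulv k d sg)) d else unshift (sadd w (mulv k d sg)) d.
Proof.
  destruct w, d, sg; unfold sadd, mulv, shift, unshift; simpl fst; simpl snd;
    f_equal; lia.
Qed.

Lemma sadd_shift x w d : sadd x (shift w d) = shift (sadd x w) d.
Proof. destruct x, w, d; unfold sadd, shift; simpl; f_equal; lia. Qed.

Lemma sadd_unshift x w d : sadd x (unshift w d) = unshift (sadd x w) d.
Proof. destruct x, w, d; unfold sadd, unshift; simpl; f_equal; lia. Qed.

Lemma sadd_0 w : sadd w (0%Z, 0%Z) = w.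
Proof. destruct w; unfold sadd; simpl; f_equal; lia. Qed.

Lemma sadd_0l w : sadd (0%Z, 0%Z) w = w.
Proof. destruct w; unfold sadd; simpl; f_equal; lia. Qed.

Section Chain.
Context (D : site -> bool) (lam : bool -> R).
Hypothesis lam_pos : forall d, 0 < lam d.
Notation coreD := (core D).
Notation en := (bond_energy D lam).
Notation energy := (energy_form D lam).
Implicit Types (f : cfg -> R) (w : site).

Definition admissible w : Prop := forall x, D x = true -> D (sadd x w) = true.

(** The particle mass carried by the translate [D + w]. At [w = 0] it is the total mass, and for
    every [w] it is at most that. *)
Definition shifted_mass f w : R := fsum (fun x => b2r (D x) * rho f (sadd x w)).

Lemma finsupp_rho_sadd f w : coreD f -> finsupp (fun x => rho f (sadd x w)).
Proof.
  intros H. apply (finsupp_comp (rho f) (fun x => sadd x w) (fun x => sadd x (sopp w))).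
  - intros x; apply saddK.
  - now apply (finsupp_rho D).
Qed.

Lemma W_le f w : coreD f -> shifted_mass f w <= fsum (rho f).
Proof.
  intros H. unfold shifted_mass.
  rewrite <- (fsum_comp (rho f) (fun x => sadd x w) (fun x => sadd x (sopp w))).
  - pose proof (finsupp_rho_sadd f w H) as h. apply fsum_le; auto; [now apply finsupp_mul_r|].
    intros x. pose proof (rho_nonneg f (sadd x w) (proj1 H)).
    unfold b2r; destruct (D x); lra.
  - intros x; apply saddK.
  - intros x; apply saddK'.
  - now apply (finsupp_rho D).
Qed.

Lemma W_0 f : coreD f -> shifted_mass f (0%Z, 0%Z) = fsum (rho f).
Proof.
  intros H. unfold shifted_mass. f_equal; extensionality x. rewrite sadd_0.
  unfold b2r. destruct (D x) eqn:E; [ring|]. rewrite (rho_outside D); auto; ring.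
Qed.

(** The product of [w] with the vector of logarithms: [exp (- 2 * dot w)] collects the factors
    [lam d ^ 2] or their inverses along any lattice path from the origin to [w]. *)
Definition dot w : R := ln (lam false) * IZR (fst w) + ln (lam true) * IZR (snd w).

Lemma exp_2ln d : exp (2 * ln (lam d)) = lam d ^ 2.
Proof.
  replace (2 * ln (lam d)) with (ln (lam d) + ln (lam d)) by ring.
  rewrite exp_plus, exp_ln by auto; ring.
Qed.

Lemma exp_m2ln d : exp (- 2 * ln (lam d)) = / lam d ^ 2.
Proof. rewrite <- exp_2ln, <- exp_Ropp. f_equal; ring. Qed.

Lemma dot_shift w d : dot (shift w d) = dot w + ln (lam d).
Proof. unfold dot, shift; destruct d; simpl; rewrite plus_IZR; ring. Qed.

Lemma dot_unshift w d : dot (unshift w d) = dot w - ln (lam d).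
Proof. unfold dot, unshift; destruct d; simpl; rewrite minus_IZR; ring. Qed.

(** The pointwise bound is summed over [D]. The site [x] pays with the bond [s x], and distinct
    sites use distinct bonds, so together they pay at most the total energy. *)
Lemma W_comparison g f w w' (s : site -> bond) (p : bond -> site) (c C : R) :
  coreD f -> 0 <= C -> 0 <= c ->
  (forall x, p (s x) = x) ->
  (forall x, D x = true ->
     rho f (sadd x w) <= g * c * rho f (sadd x w') + C * en f (s x)) ->
  shifted_mass f w <= g * c * shifted_mass f w' + C * energy f.
Proof.
  intros H C0 c0 i B. destruct (energy_split D lam f H) as [h ->].
  assert (P : forall b, 0 <= en f b) by (intros b; apply en_nonneg; auto; apply H).
  destruct (fsum_inj_le (en f) s p i h P) as [h' le].
  apply (Rmult_le_compat_l C) in le; auto.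
  apply (Rle_trans _ (g * c * shifted_mass f w' + C * fsum (fun x => en f (s x)))); [|lra].
  unfold shifted_mass.
  pose proof (finsupp_mul_r (fun x => b2r (D x)) _ (finsupp_rho_sadd f w H)) as h1.
  pose proof (finsupp_mul_r (fun x => b2r (D x)) _ (finsupp_rho_sadd f w' H)) as h2.
  rewrite <- fsum_lin by auto. apply fsum_le; auto; [now apply finsupp_lin|].
  intros x. specialize (P (s x)). unfold b2r. destruct (D x) eqn:E.
  - specialize (B x E). lra.
  - nra.
Qed.

(** A forward step uses the bond starting at [x + w], a backward step the bond ending there.
    Admissibility of both endpoints keeps the bond inside [D]. *)
Lemma W_step g d (sg : bool) : 1 < g -> exists C, 0 <= C /\ forall f w, coreD f ->
  let w' := if sg then shift w d else unshift w d in admissible w -> admissible w' ->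
  shifted_mass f w <= g * exp (- 2 * (dot w' - dot w)) * shifted_mass f w' + C * energy f.
Proof.
  intros hg. destruct (bond_density_bounds D lam lam_pos g d hg) as (C & C0 & H).
  exists C; split; auto. intros f w hf w' a a'.
  destruct sg; unfold w'.
  - rewrite dot_shift.
    replace (- 2 * (dot w + ln (lam d) - dot w)) with (- 2 * ln (lam d)) by ring.
    rewrite exp_m2ln.
    apply (W_comparison g f w _ (fun x => (sadd x w, d)) (fun b => sadd (fst b) (sopp w)));
      auto.
    + left; apply Rinv_0_lt_compat. specialize (lam_pos d); nra.
    + intros x; apply saddK.
    + intros x dx. rewrite sadd_shift. apply H; [apply hf| |]; auto.
      rewrite <- sadd_shift; auto.
  - rewrite dot_unshift.
    replace (- 2 * (dot w - ln (lam d) - dot w)) with (2 * ln (lam d)) by ring.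
    rewrite exp_2ln.
    apply (W_comparison g f w _ (fun x => (unshift (sadd x w) d, d))
             (fun b => sadd (shift (fst b) d) (sopp w))); auto.
    + specialize (lam_pos d); nra.
    + intros x. simpl. rewrite unshiftK. apply saddK.
    + intros x dx. rewrite sadd_unshift.
      rewrite <- (unshiftK (sadd x w) d) at 1. apply H; [apply hf| |].
      * rewrite <- sadd_unshift; auto.
      * rewrite unshiftK; auto.
Qed.

(** The outcome of chaining [n] steps from the origin to [w]: the exponential factors telescope,
    each step costs a factor [g], and the energy constant is uniform in [f]. *)
Definition reach (g : R) (n : nat) w : Prop := exists C, 0 <= C /\ forall f, coreD f ->
  shifted_mass f (0%Z, 0%Z) <= g ^ n * exp (- 2 * dot w) * shifted_mass f w + C * energy f.

Lemma reach_0 g : reach g 0 (0%Z, 0%Z).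
Proof.
  exists 0; split; [lra|]. intros f H. unfold dot; simpl.
  replace (-2 * _) with 0 by ring. rewrite exp_0. lra.
Qed.

Lemma reach_step g n w d (sg : bool) : 1 < g ->
  let w' := if sg then shift w d else unshift w d in admissible w -> admissible w' ->
  reach g n w -> reach g (S n) w'.
Proof.
  intros hg w' a a' (C & C0 & H). destruct (W_step g d sg hg) as (C' & C0' & H').
  assert (K : 0 < g ^ n * exp (- 2 * dot w)).
  { apply Rmult_lt_0_compat; [apply pow_lt; lra|apply exp_pos]. }
  (* The energy paid in the new step is multiplied by the factor accumulated before it. *)
  exists (g ^ n * exp (- 2 * dot w) * C' + C). split; [nra|].
  intros f hf. specialize (H f hf). specialize (H' f w hf a a').
  fold w' in H'. apply (Rmult_le_compat_l _ _ _ (Rlt_le _ _ K)) in H'.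
  assert (E : exp (- 2 * dot w') = exp (- 2 * dot w) * exp (- 2 * (dot w' - dot w))).
  { rewrite <- exp_plus. f_equal; ring. }
  simpl pow. rewrite E. nra.
Qed.

Lemma reach_line g n w d sg k : 1 < g -> reach g n w ->
  (forall j, (j <= k)%nat -> admissible (sadd w (mulv j d sg))) ->
  reach g (n + k) (sadd w (mulv k d sg)).
Proof.
  intros hg H. induction k as [|k IH]; intros a.
  - rewrite Nat.add_0_r. replace (sadd w (mulv 0 d sg)) with w; auto.
    symmetry. replace (mulv 0 d sg) with (0%Z, 0%Z) by (destruct d, sg; reflexivity).
    apply sadd_0.
  - rewrite Nat.add_succ_r, sadd_step. apply reach_step; auto.
    rewrite <- sadd_step; auto.
Qed.

(* Along an admissible staircase to [w] with [dot w > 0] the density picks up a factor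
   [exp (- 2 * dot w)], of which at most [exp (dot w)] is lost to the Young constants. *)
Lemma form_gap d sg k d' sg' k' :
  let w := sadd (mulv k d sg) (mulv k' d' sg') in 0 < dot w ->
  (forall j, (j <= k)%nat -> admissible (mulv j d sg)) ->
  (forall j, (j <= k')%nat -> admissible (sadd (mulv k d sg) (mulv j d' sg'))) ->
  exists delta, 0 < delta /\ forall f, coreD f -> delta * (sq f - f vac ^ 2) <= energy f.
Proof.
  intros w pos a a'.
  (* The denominator [INR n + 1] is never zero; it gives [g > 1], as Young's inequality demands,
     together with [g ^ n <= exp s]. *)
  set (n := (k + k')%nat). set (s := dot w) in *. set (g := exp (s / (INR n + 1))).
  pose proof (pos_INR n) as n0.
  assert (s' : 0 < s / (INR n + 1)) by (apply Rdiv_lt_0_compat; lra).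
  assert (hg : 1 < g) by (unfold g; apply (Rle_lt_trans _ (exp 0));
    [rewrite exp_0; lra|now apply exp_increasing]).
  assert (R1 : reach g k (mulv k d sg)).
  { rewrite <- (sadd_0l (mulv k d sg)). apply (reach_line g 0); [auto|apply reach_0|].
    intros j; rewrite sadd_0l; auto. }
  pose proof (reach_line g k _ d' sg' k' hg R1 a') as (C & C0 & H).
  fold n w s in H.
  assert (G : g ^ n <= exp s).
  { unfold g. rewrite <- Rpower_pow by apply exp_pos. unfold Rpower.
    rewrite ln_exp. destruct (Req_dec (INR n * (s / (INR n + 1))) s) as [->|h]; [lra|].
    left; apply exp_increasing.
    assert (E : s - INR n * (s / (INR n + 1)) = s / (INR n + 1)) by (field; lra). lra. }
  assert (Q : g ^ n * exp (- 2 * s) <= exp (- s)).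
  { replace (- s) with (s + - 2 * s) by ring. rewrite exp_plus.
    apply Rmult_le_compat_r; [left; apply exp_pos|auto]. }
  assert (Q1 : exp (- s) < 1) by (rewrite <- exp_0; apply exp_increasing; lra).
  (* With [q = exp (- s)] and the total mass [r], the chain reads [r <= q * r + C * energy], that is
     [(1 - q) * r <= C * energy]. Using [C + 1] in place of [C] avoids dividing by zero. *)
  exists ((1 - exp (- s)) / (C + 1)). split; [apply Rdiv_lt_0_compat; lra|].
  intros f hf. specialize (H f hf). rewrite W_0 in H by auto.
  pose proof (W_le f w hf) as M. pose proof (nonvac_le_rho D f hf) as N.
  rewrite sq_vac by apply hf.
  pose proof (energy_nonneg D lam f hf) as E0.
  assert (R0 : 0 <= fsum (rho f)).
  { apply fsum_nonneg; [now apply (finsupp_rho D)|]. intros x; apply rho_nonneg, hf. }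
  set (X := fsum _) in N |- *. replace (X + f vac ^ 2 - f vac ^ 2) with X by ring.
  set (q := exp (- s)) in *. set (r := fsum (rho f)) in *.
  pose proof (exp_pos (- 2 * s)). pose proof (pow_lt g n ltac:(lra)).
  assert (g ^ n * exp (-2 * s) * shifted_mass f w <= q * r).
  { apply (Rle_trans _ (g ^ n * exp (-2 * s) * r)); [apply Rmult_le_compat_l; nra|].
    now apply Rmult_le_compat_r. }
  apply (Rmult_le_reg_l (C + 1)); [lra|].
  replace ((C + 1) * ((1 - q) / (C + 1) * X)) with ((1 - q) * X) by (field; lra).
  assert ((1 - q) * X <= (1 - q) * r) by (apply Rmult_le_compat_l; lra).
  lra.
Qed.

End Chain.

(** * Approximate solution of (H - mu) psi = phi *)

(** Stated by a covering list, so that no occupied sites have to be counted. *)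
Definition particles_le (M : nat) (eta : cfg) : Prop :=
  exists l, (length l <= M)%nat /\ forall x, eta x = true -> In x l.

Lemma nle_bswap M b eta : particles_le M eta -> particles_le M (bswap b eta).
Proof.
  intros (l & n & H).
  set (t := fun z => if site_eqb z (src b) then tgt b
                     else if site_eqb z (tgt b) then src b else z).
  exists (map t l). rewrite length_map; split; auto. intros x h.
  replace x with (t (t x)).
  2: { unfold t. generalize (src b) (tgt b). intros a c.
       destruct (site_eqbP x a); [|destruct (site_eqbP x c)]; subst; case_sites; auto. }
  apply in_map, H. rewrite <- h. unfold bswap, swap, t; case_sites; reflexivity.
Qed.

Lemma rsum_b2r {T : Type} (p : T -> bool) (L : list T) :
  rsum (map (fun e => b2r (p e)) L) = INR (length (filter p L)).
Proof.
  induction L as [|e L IH]; [reflexivity|]. simpl map; simpl rsum; simpl filter.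
  rewrite IH. unfold b2r. destruct (p e); [|lra].
  change (length (e :: ?l)) with (S (length l)). rewrite S_INR. lra.
Qed.

(** A touched bond is one of the four bonds at some particle. *)
Lemma count_touch M eta (B : list bond) : particles_le M eta -> NoDup B ->
  rsum (map (fun b => b2r (touch b eta)) B) <= 4 * INR M.
Proof.
  intros (l & n & H) nB. rewrite rsum_b2r.
  set (B' := flat_map bonds_at l).
  assert (E : length B' = (4 * length l)%nat).
  { unfold B'. clear. induction l as [|x l IH]; simpl; [auto|lia]. }
  apply (Rle_trans _ (INR (length B'))).
  - apply le_INR, NoDup_incl_length; [now apply NoDup_filter|].
    intros b i. apply filter_In in i as [_ i]. now apply (touch_bonds eta).
  - rewrite E, mult_INR. apply le_INR in n. simpl INR. lra.
Qed.

(** * Boundedness of the Hamiltonian at bounded particle number *)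

Section Resolvent.
Context (D : site -> bool) (lam : bool -> R).
Notation coreD := (core D).
Notation tb := (bond_term D lam).
Notation Hop := (ham D lam).
Notation energy := (energy_form D lam).
Implicit Types (f g : cfg -> R).

Definition supp_le (M : nat) f : Prop := forall eta, f eta <> 0 -> particles_le M eta.

Lemma ps_exists f : coreD f -> exists M, supp_le M f.
Proof.
  intros H. destruct (sites_finite D f H) as [S h].
  exists (length S). intros eta z. exists S. split; eauto.
Qed.

Lemma ps_lin M a c f g : supp_le M f -> supp_le M g -> supp_le M (fun e => a * f e + c * g e).
Proof.
  intros hf hg e h. destruct (classic (f e = 0)) as [z|z]; auto.
  apply hg. intros z'; apply h; rewrite z, z'; ring.
Qed.

Lemma bond_term_ps M b f eta : supp_le M f -> tb b f eta <> 0 -> particles_le M eta.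
Proof.
  intros H h. apply bond_term_nz in h as (_ & _ & _ & [z|z]); auto.
  apply H in z. rewrite <- (bswapK b). now apply nle_bswap.
Qed.

Lemma ps_ham M f : supp_le M f -> supp_le M (Hop f).
Proof. intros H e h. apply fsum_nz in h as [b h]. now apply (bond_term_ps M) in h. Qed.

(** The local term is a projection vanishing on empty bonds. On a pair of singly occupied
    configurations, the difference of the two sides is the squared component orthogonal to [phi],
    namely [(p + l * q) ^ 2 / (1 + l ^ 2)] up to the order of the pair. *)
Lemma bond_term_sq_le b f : finsupp f -> finsupp (tb b f) ->
  fsum (fun eta => tb b f eta ^ 2) <= fsum (fun eta => b2r (touch b eta) * f eta ^ 2).
Proof.
  intros hf ht.
  pose proof (finsupp_mul_r (fun eta => b2r (touch b eta)) _ (finsupp_sq _ hf)) as h1.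
  pose proof (finsupp_sq _ ht) as h2.
  assert (H : 0 <= fsum (fun eta => 1 * (b2r (touch b eta) * f eta ^ 2)
                                    + -1 * tb b f eta ^ 2)).
  { apply (fsum_sym_nonneg _ (bswap b) (bswapK b)); [now apply finsupp_lin|].
    intros eta. rewrite touch_bswap.
    destruct (D (src b) && D (tgt b))%bool eqn:E.
    - apply andb_prop in E as [d d'].
      rewrite !bond_termE, bswapK, bswap_src, bswap_tgt by auto. unfold touch.
      set (l := lam (snd b)). set (p := f eta). set (q := f (bswap b eta)).
      assert (P : 0 < 1 + l ^ 2) by nra.
      assert (I : 0 <= / (1 + l ^ 2)) by (left; now apply Rinv_0_lt_compat).
      destruct (eta (src b)), (eta (tgt b)); unfold b2r; simpl orb; cbv iota.
      + lra.
      + apply (Rle_trans _ ((p + l * q) ^ 2 * / (1 + l ^ 2))).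
        * apply Rmult_le_pos; auto; apply pow2_ge_0.
        * right; field; lra.
      + apply (Rle_trans _ ((l * p + q) ^ 2 * / (1 + l ^ 2))).
        * apply Rmult_le_pos; auto; apply pow2_ge_0.
        * right; field; lra.
      + lra.
    - rewrite !bond_term_outside by auto. unfold b2r; destruct (touch b eta); nra. }
  rewrite fsum_lin in H by auto. lra.
Qed.

(** At most [4 * M] bonds touch a configuration with [M] particles. This count enters twice: in the
    Cauchy-Schwarz inequality over the bonds at a fixed configuration, and, after [bond_term_sq_le]
    on each bond, when the touching bonds are summed again. *)
Lemma ham_bounded M f : coreD f -> supp_le M f -> sq (Hop f) <= (4 * INR M) ^ 2 * sq f.
Proof.
  intros hf hp. destruct (bond_term_supp D lam f hf) as (L0 & B0 & s0).
  destruct (proj1 hf) as [Lf sf].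
  set (L := nodup ceq (L0 ++ Lf)). set (B := nodup ceq B0).
  assert (nL : NoDup L) by apply NoDup_nodup.
  assert (nB : NoDup B) by apply NoDup_nodup.
  assert (sL : forall eta, f eta <> 0 -> In eta L)
    by (intros; apply nodup_In, in_or_app; auto).
  assert (s : forall eta b, tb b f eta <> 0 -> In eta L /\ In b B).
  { intros e b h. apply s0 in h as [h h'].
    split; apply nodup_In; [apply in_or_app|]; auto. }
  pose proof (pos_INR M) as M0.
  assert (HE : forall eta, Hop f eta = rsum (map (fun b => tb b f eta) B)).
  { intros e. apply fsumE; auto. intros b h; now apply s in h. }
  unfold sq. rewrite (fsumE (fun eta => f eta ^ 2) L); auto.
  2: { intros e h. apply sL. intros z; apply h; rewrite z; ring. }
  rewrite (fsumE _ L); auto.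
  2: { intros e h. destruct (fsum_nz (fun b => tb b f e)) as [b h'].
       - intros z; apply h. unfold ham. rewrite z; ring.
       - now apply s in h'. }
  (* The summand [0 * 0] gives the terms the shape of [rsum_lin]. *)
  apply (Rle_trans _ (rsum (map (fun eta => 4 * INR M * rsum (map (fun b => tb b f eta ^ 2) B)
     + 0 * 0) L))).
  { apply rsum_le. intros eta _. rewrite HE, Rmult_0_l, Rplus_0_r.
    assert (P : 0 <= rsum (map (fun b => tb b f eta ^ 2) B))
      by (apply rsum_nonneg; intros; apply pow2_ge_0).
    destruct (classic (particles_le M eta)) as [n|n].
    - pose proof (count_touch M eta B n nB) as c.
      rewrite (rsum_ext _ (fun b => b2r (touch b eta) * tb b f eta)).
      + apply (Rle_trans _ _ _ (rsum_CS _ _ _)).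
        apply Rmult_le_compat_r; auto.
        rewrite (rsum_ext _ (fun b => b2r (touch b eta))); auto.
        intros b _. unfold b2r; destruct (touch b eta); ring.
      + intros b _. destruct (classic (tb b f eta = 0)) as [->|z]; [ring|].
        apply bond_term_nz in z as (_ & _ & -> & _). unfold b2r; ring.
    - rewrite (rsum_zero (fun b => tb b f eta)).
      + nra.
      + intros b _. apply NNPP; intros h. apply n. now apply (bond_term_ps M) in h. }
  rewrite rsum_lin, Rmult_0_l, Rplus_0_r, rsum_exchange.
  replace ((4 * INR M) ^ 2 * rsum (map (fun eta => f eta ^ 2) L))
    with (4 * INR M * (4 * INR M * rsum (map (fun eta => f eta ^ 2) L))) by ring.
  apply Rmult_le_compat_l; [lra|].
  apply (Rle_trans _
    (rsum (map (fun b => rsum (map (fun eta => b2r (touch b eta) * f eta ^ 2) L)) B))).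
  { apply rsum_le. intros b _.
    rewrite <- (fsumE (fun eta => tb b f eta ^ 2) L); auto.
    2: { intros e h. apply (s e b). intros z; apply h; rewrite z; ring. }
    rewrite <- (fsumE _ L); auto.
    2: { intros e h. apply sL. intros z; apply h; rewrite z; ring. }
    apply bond_term_sq_le; [apply hf|]. exists L. intros e h; now apply s in h. }
  rewrite <- (rsum_exchange (fun eta b => b2r (touch b eta) * f eta ^ 2)).
  replace (4 * INR M * rsum (map (fun eta => f eta ^ 2) L))
    with (rsum (map (fun eta => 4 * INR M * f eta ^ 2 + 0 * 0) L))
    by (rewrite (rsum_lin (4 * INR M) 0 _ (fun _ => 0)); ring).
  apply rsum_le. intros eta _.
  destruct (classic (f eta = 0)) as [z|z].
  - rewrite z, rsum_zero; [|intros; ring]. nra.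
  - rewrite (rsum_ext _ (fun b => f eta ^ 2 * b2r (touch b eta) + 0 * 0)) by (intros; ring).
    rewrite (rsum_lin (f eta ^ 2) 0 _ (fun _ => 0)).
    pose proof (count_touch M eta B (hp eta z) nB). nra.
Qed.

(** * The shifted operator [H - mu] inside the gap *)

Context (delta : R).
Hypothesis form : forall f, coreD f -> delta * (sq f - f vac ^ 2) <= energy f.
Context (mu : R).
Hypothesis mu_gap : 0 < mu < delta.

Definition Amu f : cfg -> R := fun eta => 1 * Hop f eta + - mu * f eta.

Lemma core_Amu f : coreD f -> coreD (Amu f).
Proof. intros H. apply core_lin; auto. now apply core_ham. Qed.

Lemma Amu_lin a c f g : coreD f -> coreD g ->
  Amu (fun e => a * f e + c * g e) = fun e => a * Amu f e + c * Amu g e.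
Proof. intros hf hg. unfold Amu. rewrite ham_lin by auto. extensionality e; ring. Qed.

Lemma Amu_vac f : Amu f vac = - mu * f vac.
Proof. unfold Amu. rewrite ham_vac. ring. Qed.

Lemma ip_Amu f : coreD f -> fsum (fun eta => f eta * Amu f eta) = energy f - mu * sq f.
Proof.
  intros H. transitivity (1 * energy f + - mu * sq f); [|ring].
  unfold energy_form, sq. rewrite <- fsum_lin.
  - f_equal; extensionality e. unfold Amu; ring.
  - apply finsupp_mul_l, H.
  - apply finsupp_sq, H.
Qed.

Lemma sq_nonneg f : finsupp f -> 0 <= sq f.
Proof. intros H. apply fsum_nonneg; [now apply finsupp_sq|]. intros; apply pow2_ge_0. Qed.

Lemma sq_lin a c f g : finsupp f -> finsupp g -> sq (fun e => a * f e + c * g e)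
  = a ^ 2 * sq f + 2 * a * c * fsum (fun e => f e * g e) + c ^ 2 * sq g.
Proof.
  intros hf hg. unfold sq.
  pose proof (finsupp_sq f hf) as h1. pose proof (finsupp_sq g hg) as h2.
  pose proof (finsupp_mul_l f g hf) as h3.
  rewrite <- fsum_lin by auto.
  replace (a ^ 2 * fsum (fun eta => f eta ^ 2) + 2 * a * c * fsum (fun e => f e * g e))
    with (fsum (fun e => a ^ 2 * f e ^ 2 + 2 * a * c * (f e * g e)))
    by now rewrite fsum_lin.
  rewrite <- (Rmult_1_l (fsum (fun e => a ^ 2 * _ + _))).
  rewrite <- fsum_lin by (auto; now apply finsupp_lin).
  f_equal; extensionality e; ring.
Qed.

(** The vacuum and its complement are treated separately. At the vacuum [H - mu] is multiplication
    by [- mu], whence the term [/ mu ^ 2]. Off the vacuum [H - mu] is coercive with constant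
    [delta - mu], and Young's inequality for the product of [f] and [Amu f] gives the other term. *)
Lemma Amu_bounded_below f : coreD f ->
  sq f <= (/ (delta - mu) ^ 2 + / mu ^ 2) * sq (Amu f).
Proof.
  intros H. set (k := delta - mu). assert (k0 : 0 < k) by (unfold k; lra).
  pose proof (core_Amu f H) as hA.
  pose proof (form f H) as F. pose proof (ip_Amu f H) as I.
  rewrite (sq_vac f (proj1 H)) in *.
  set (X := fsum (fun eta => if ceq eta vac then 0 else f eta ^ 2)) in *.
  set (v := f vac) in *. set (G := sq (Amu f)).
  assert (h1 : finsupp (fun eta => if ceq eta vac then 0 else f eta ^ 2))
    by apply finsupp_nonvac, H.
  assert (h2 : finsupp (fun eta => Amu f eta ^ 2)) by apply finsupp_sq, hA.
  assert (h3 : finsupp dvac) by apply (core_dvac D).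
  pose proof (finsupp_lin (k / 2) (/ (2 * k)) _ _ h1 h2) as h12.
  assert (dv : fsum dvac = 1).
  { rewrite (fsum_single _ vac); unfold dvac; [destruct (ceq vac vac); congruence|].
    intros e. destruct (ceq e vac); congruence. }
  (* The vacuum contributes exactly [- mu * v ^ 2], which cancels against the same term in
     [energy - mu * sq f]. Writing it with [dvac] puts it under the sum, so that the comparison is
     pointwise. *)
  assert (U : fsum (fun eta => f eta * Amu f eta)
              <= k / 2 * X + / (2 * k) * G - mu * v ^ 2).
  { apply (Rle_trans _ (1 * (k / 2 * X + / (2 * k) * G) + - mu * v ^ 2 * fsum dvac));
      [|rewrite dv; lra].
    unfold X, G, sq. rewrite <- (fsum_lin (k / 2) (/ (2 * k))) by auto.
    rewrite <- fsum_lin by auto.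
    apply fsum_le; [apply finsupp_mul_l, H|now apply finsupp_lin|].
    intros eta. unfold dvac.
    assert (i0 : 0 < / (2 * k)) by (apply Rinv_0_lt_compat; lra).
    destruct (ceq eta vac) as [->|n].
    - rewrite Amu_vac. fold v.
      pose proof (Rmult_le_pos _ _ (Rlt_le _ _ i0) (pow2_ge_0 (- mu * v))). lra.
    - set (p := f eta). set (q := Amu f eta).
      assert (E : k / 2 * p ^ 2 + / (2 * k) * q ^ 2 - p * q = / (2 * k) * (k * p - q) ^ 2)
        by (field; lra).
      pose proof (Rmult_le_pos _ _ (Rlt_le _ _ i0) (pow2_ge_0 (k * p - q))). lra. }
  rewrite I in U.
  assert (X1 : X <= / k ^ 2 * G).
  { assert (k / 2 * X <= / (2 * k) * G) by (unfold k in *; nra).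
    apply (Rmult_le_reg_l (k / 2)); [lra|].
    replace (k / 2 * (/ k ^ 2 * G)) with (/ (2 * k) * G) by (field; lra). auto. }
  assert (V1 : v ^ 2 <= / mu ^ 2 * G).
  { unfold G. rewrite (sq_vac (Amu f) (proj1 hA)), Amu_vac. fold v.
    assert (0 <= fsum (fun eta => if ceq eta vac then 0 else Amu f eta ^ 2)).
    { apply fsum_nonneg; [apply finsupp_nonvac, hA|].
      intros e; destruct (ceq e vac); [lra|apply pow2_ge_0]. }
    assert (0 < / mu ^ 2) by (apply Rinv_0_lt_compat; nra).
    replace (v ^ 2) with (/ mu ^ 2 * (- mu * v) ^ 2) at 1 by (field; lra).
    apply Rmult_le_compat_l; lra. }
  lra.
Qed.

(* Richardson iteration: the residual [r] is replaced by [r - tau (H - mu) r], a strict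
   contraction on the vectors with at most [M] particles and no vacuum component, on
   which [H] is bounded and [H - mu] coercive. *)
Lemma dense_range0 phi : coreD phi -> phi vac = 0 -> forall eps, 0 < eps ->
  exists psi, coreD psi /\ sq (fun eta => 1 * Amu psi eta + -1 * phi eta) <= eps.
Proof.
  intros hphi v0. destruct (ps_exists phi hphi) as [M hM].
  set (k := delta - mu). assert (k0 : 0 < k) by (unfold k; lra).
  (* The first two terms bound [sq (Amu r)] by a multiple of [sq r]; the rest ensures
     [k ^ 2 / B < 1]. *)
  set (B := 2 * (4 * INR M) ^ 2 + 2 * mu ^ 2 + k ^ 2 + 1).
  assert (B0 : k ^ 2 < B).
  { unfold B. pose proof (pow2_ge_0 (4 * INR M)). pose proof (pow2_ge_0 mu). lra. }
  assert (k2 : 0 < k ^ 2) by nra.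
  (* This [tau] minimises [1 - 2 * tau * k + tau ^ 2 * B], and the minimum is [q]. *)
  set (tau := k / B). set (q := 1 - k ^ 2 / B).
  assert (q0 : 0 < k ^ 2 / B) by (apply Rdiv_lt_0_compat; lra).
  assert (q1 : k ^ 2 / B < 1).
  { apply (Rmult_lt_reg_r B); [lra|]. unfold Rdiv. rewrite Rmult_assoc, Rinv_l; lra. }
  assert (step : forall n, exists psi, coreD psi /\
    let r := fun eta => 1 * Amu psi eta + -1 * phi eta in
    supp_le M r /\ r vac = 0 /\ sq r <= q ^ n * sq phi).
  { induction n as [|n (psi & hpsi & hr)].
    (* The iteration starts from the zero vector, with residual [- phi]; the form as a combination
       lets the linearity lemmas apply. *)
    - exists (fun e => 0 * phi e + 0 * phi e).
      split; [now apply core_lin|].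
      rewrite Amu_lin by auto.
      replace (fun eta => 1 * (0 * Amu phi eta + 0 * Amu phi eta) + -1 * phi eta)
        with (fun eta => -1 * phi eta + 0 * phi eta) by (extensionality e; ring).
      intros r. split; [now apply ps_lin|]. split; [unfold r; rewrite v0; ring|].
      unfold r. rewrite sq_lin by apply hphi. simpl. lra.
    - set (r := fun eta => 1 * Amu psi eta + -1 * phi eta) in hr. cbv zeta in hr.
      destruct hr as (hp & rv & le).
      assert (hr : coreD r) by (apply core_lin; auto; now apply core_Amu).
      exists (fun e => 1 * psi e + - tau * r e). split; [now apply core_lin|].
      rewrite Amu_lin by auto.
      replace (fun eta => 1 * (1 * Amu psi eta + - tau * Amu r eta) + -1 * phi eta)
        with (fun eta => 1 * r eta + - tau * Amu r eta)
        by (extensionality e; unfold r; ring).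
      pose proof (core_Amu r hr) as hA.
      cbv zeta. split; [|split].
      + apply ps_lin; auto. apply ps_lin; auto. now apply ps_ham.
      + rewrite Amu_vac, rv; ring.
      + rewrite sq_lin by (apply hr || apply hA). rewrite ip_Amu by auto.
        pose proof (form r hr) as F. rewrite rv in F.
        pose proof (sq_nonneg r (proj1 hr)) as S0.
        assert (S1 : sq (Amu r) <= B * sq r).
        { pose proof (ham_bounded M r hr hp) as HB.
          assert (hH : finsupp (Hop r)) by (apply core_ham, hr).
          assert (P : sq (Amu r) <= 2 * sq (Hop r) + 2 * mu ^ 2 * sq r).
          { unfold sq. rewrite <- fsum_lin by (apply finsupp_sq; auto; apply hr).
            apply fsum_le.
            - apply finsupp_sq, hA.
            - apply finsupp_lin; apply finsupp_sq; auto; apply hr.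
            - intros e. unfold Amu. pose proof (pow2_ge_0 (Hop r e + mu * r e)). nra. }
          unfold B. nra. }
        assert (t0 : 0 < tau) by (unfold tau; apply Rdiv_lt_0_compat; lra).
        assert (S2 : k * sq r <= energy r - mu * sq r) by (unfold k; lra).
        apply (Rle_trans _ ((1 - 2 * tau * k + tau ^ 2 * B) * sq r)).
        * assert (tau ^ 2 * sq (Amu r) <= tau ^ 2 * (B * sq r))
            by (apply Rmult_le_compat_l; nra).
          assert (tau * (k * sq r) <= tau * (energy r - mu * sq r))
            by (apply Rmult_le_compat_l; lra).
          lra.
        * replace (1 - 2 * tau * k + tau ^ 2 * B) with q
            by (unfold q, tau; field; lra).
          simpl. rewrite Rmult_assoc. apply Rmult_le_compat_l; [unfold q; lra|auto]. }
  intros eps e0. pose proof (sq_nonneg phi (proj1 hphi)) as p0.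
  destruct (pow_lt_1_zero q) with (y := eps / (sq phi + 1)) as [n hn].
  - rewrite Rabs_right; unfold q; lra.
  - apply Rdiv_lt_0_compat; lra.
  - destruct (step n) as (psi & hpsi & _ & _ & le). exists psi; split; auto.
    apply (Rle_trans _ _ _ le). specialize (hn n (le_n n)).
    pose proof (Rle_abs (q ^ n)).
    apply (Rle_trans _ (eps / (sq phi + 1) * (sq phi + 1))); [|right; field; lra].
    assert (0 < eps / (sq phi + 1)) by (apply Rdiv_lt_0_compat; lra).
    nra.
Qed.

(** The vacuum component is solved exactly, because [H - mu] multiplies [dvac] by [- mu]; the
    remainder has no vacuum component. *)
Lemma dense_range phi : coreD phi -> forall eps, 0 < eps ->
  exists psi, coreD psi /\ sq (fun eta => 1 * Amu psi eta + -1 * phi eta) <= eps.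
Proof.
  intros H eps e0. pose proof (core_dvac D) as hd.
  destruct (dense_range0 (fun e => 1 * phi e + - phi vac * dvac e)) with (eps := eps)
    as (psi & hpsi & le); auto.
  - now apply core_lin.
  - unfold dvac. destruct (ceq vac vac); [ring|congruence].
  - exists (fun e => 1 * psi e + - phi vac / mu * dvac e). split; [now apply core_lin|].
    rewrite Amu_lin by auto.
    match goal with |- sq ?u <= _ => match type of le with sq ?v <= _ =>
      replace u with v; auto end end.
    extensionality e. unfold Amu at 3. rewrite ham_dvac. field; lra.
Qed.

End Resolvent.

(** * The closed operator and its resolvent *)

(** One operation in place of [vsub] and [vscale], so that a single norm estimate and a single limit
    rule serve throughout. *)
Definition vlin (a : R) (u : vec) (c : R) (v : vec) : vec :=
  fun e => (a * fst (u e) + c * fst (v e), a * snd (u e) + c * snd (v e)).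

Lemma vec_ext (u v : vec) :
  (forall e, fst (u e) = fst (v e)) -> (forall e, snd (u e) = snd (v e)) -> u = v.
Proof.
  intros h h'. extensionality e. rewrite (surjective_pairing (u e)), h, h'.
  now rewrite <- surjective_pairing.
Qed.

Ltac vring := apply vec_ext; intros; unfold vlin, vsub, vscale, csub, cscale; simpl; ring.

Lemma vsub_vl u v : vsub u v = vlin 1 u (-1) v.
Proof. vring. Qed.

Lemma vsub_vscale u mu v : vsub u (vscale mu v) = vlin 1 u (- mu) v.
Proof. vring. Qed.

Lemma cabs2_nonneg z : 0 <= cabs2 z.
Proof. unfold cabs2; nra. Qed.

Lemma cabs2_0 z : cabs2 z <= 0 -> z = c0.
Proof.
  destruct z as [x y]; unfold cabs2, c0; simpl. intros h.
  f_equal; apply Rsqr_0_uniq; unfold Rsqr; nra.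
Qed.

Lemma sqnorm_mono u r s : sqnorm_le u r -> r <= s -> sqnorm_le u s.
Proof. intros h l L n. specialize (h L n). lra. Qed.

Lemma sqnorm_point u r e : sqnorm_le u r -> cabs2 (u e) <= r.
Proof.
  intros h. specialize (h [e]). simpl in h. rewrite Rplus_0_r in h.
  apply h. constructor; [easy|constructor].
Qed.

(** From [(x + y) ^ 2 <= 2 * x ^ 2 + 2 * y ^ 2]. It replaces the triangle inequality and avoids
    square roots; the lost constants do no harm to the qualitative estimates below. *)
Lemma sqnorm_vl a u c v r s : sqnorm_le u r -> sqnorm_le v s ->
  sqnorm_le (vlin a u c v) (2 * a ^ 2 * r + 2 * c ^ 2 * s).
Proof.
  intros hu hv L n. specialize (hu L n). specialize (hv L n).
  apply (Rle_trans _ (2 * a ^ 2 * rsum (map (fun e => cabs2 (u e)) L)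
                      + 2 * c ^ 2 * rsum (map (fun e => cabs2 (v e)) L))).
  - rewrite <- rsum_lin. apply rsum_le. intros e _. unfold vlin, cabs2; simpl.
    destruct (u e) as [x y], (v e) as [x' y']; simpl.
    pose proof (pow2_ge_0 (a * x - c * x')). pose proof (pow2_ge_0 (a * y - c * y')). nra.
  - pose proof (pow2_ge_0 a). pose proof (pow2_ge_0 c).
    apply Rplus_le_compat; apply Rmult_le_compat_l; lra.
Qed.

Lemma sqnorm_lim u r c : 0 <= c ->
  (forall eps, 0 < eps -> sqnorm_le u (r + c * eps)) -> sqnorm_le u r.
Proof.
  intros c1 H L n. apply Rnot_lt_le. intros h.
  set (x := rsum (map (fun e => cabs2 (u e)) L)) in h.
  set (eps := (x - r) / (2 * (c + 1))).
  assert (e0 : 0 < eps) by (apply Rdiv_lt_0_compat; lra).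
  specialize (H eps e0 L n). fold x in H.
  assert (E : (c + 1) * eps = (x - r) / 2) by (unfold eps; field; lra). lra.
Qed.

Lemma conv_vl a c s u t v : conv s u -> conv t v ->
  conv (fun n => vlin a (s n) c (t n)) (vlin a u c v).
Proof.
  intros cs ht eps e0. set (K := 2 * a ^ 2 + 2 * c ^ 2 + 1).
  pose proof (pow2_ge_0 a). pose proof (pow2_ge_0 c).
  assert (K1 : 0 < K) by (unfold K; lra).
  assert (K0 : 0 < eps / K) by (apply Rdiv_lt_0_compat; lra).
  destruct (cs _ K0) as [N hN]. destruct (ht _ K0) as [N' hN'].
  exists (max N N'). intros n l.
  replace (vsub _ _) with (vlin a (vsub (s n) u) c (vsub (t n) v)) by vring.
  eapply sqnorm_mono; [apply sqnorm_vl; [apply hN|apply hN']; lia|].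
  apply (Rle_trans _ (K * (eps / K))); [|right; field; lra].
  set (e := eps / K) in *. unfold K. nra.
Qed.

(** * Completeness and approximation by finitely supported vectors *)

Section Complete.
Context (s : nat -> vec).
Hypothesis cauchy : forall eps, 0 < eps -> exists N, forall n m,
  (N <= n)%nat -> (N <= m)%nat -> sqnorm_le (vsub (s n) (s m)) eps.

Lemma cauchy_point (p : cpx -> R) (e : cfg) :
  (forall z w, (p z - p w) ^ 2 <= cabs2 (csub z w)) -> Cauchy_crit (fun n => p (s n e)).
Proof.
  intros hp eps e0. destruct (cauchy (eps ^ 2 / 4)) as [N H]; [nra|].
  exists N. intros n m hn hm. specialize (H n m hn hm).
  apply (sqnorm_point _ _ e) in H. specialize (hp (s n e) (s m e)).
  unfold Rdist. apply Rabs_def1; unfold vsub in H; nra.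
Qed.

Lemma rsum_cv (F : nat -> cfg -> R) (G : cfg -> R) L :
  (forall e, Un_cv (fun n => F n e) (G e)) ->
  Un_cv (fun n => rsum (map (F n) L)) (rsum (map G L)).
Proof.
  intros H. induction L as [|e L IH]; simpl.
  - intros eps e0. exists 0%nat. intros; unfold Rdist; rewrite Rminus_0_r, Rabs_R0; auto.
  - now apply CV_plus.
Qed.

Lemma cst_cv c : Un_cv (fun _ => c) c.
Proof.
  intros eps e0. exists 0%nat. intros; unfold Rdist. now rewrite Rminus_diag, Rabs_R0.
Qed.

(** The limit is taken at each configuration. A sum over a finite list passes to the limit, so the
    Cauchy bound on such sums is inherited by the limit. *)
Lemma l2_complete : exists u, conv s u.
Proof.
  assert (C1 : forall e, Cauchy_crit (fun n => fst (s n e))).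
  { intros e; apply (cauchy_point fst). intros z w.
    unfold cabs2, csub; cbn [fst snd]. pose proof (pow2_ge_0 (snd z - snd w)). lra. }
  assert (C2 : forall e, Cauchy_crit (fun n => snd (s n e))).
  { intros e; apply (cauchy_point snd). intros z w.
    unfold cabs2, csub; cbn [fst snd]. pose proof (pow2_ge_0 (fst z - fst w)). lra. }
  pose (u := (fun e => (proj1_sig (R_complete _ (C1 e)), proj1_sig (R_complete _ (C2 e))))
             : vec).
  exists u.
  intros eps e0. destruct (cauchy eps e0) as [N H]. exists N. intros n hn L nL.
  assert (K : Un_cv (fun m => rsum (map (fun e => cabs2 (vsub (s n) (s m) e)) L))
                    (rsum (map (fun e => cabs2 (vsub (s n) u e)) L))).
  { apply rsum_cv. intros e. unfold cabs2, vsub, csub, u; simpl.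
    destruct (R_complete _ (C1 e)) as [x hx], (R_complete _ (C2 e)) as [y hy]; simpl.
    apply CV_plus; apply CV_mult; apply CV_minus; auto using cst_cv. }
  apply Rnot_lt_le. intros h. set (x := rsum _) in h.
  destruct (K (x - eps)) as [M hM]; [lra|].
  specialize (hM (max M N) ltac:(lia)). specialize (H n (max M N) hn ltac:(lia) L nL).
  unfold Rdist in hM. apply Rabs_def2 in hM. fold x in hM. lra.
Qed.
End Complete.

(** If the sum over [L] is within [eps] of the supremum of all finite sums, then any finite set of
    configurations outside [L] carries less than [eps]. *)
Lemma truncation u B : sqnorm_le u B -> forall eps, 0 < eps ->
  exists L, sqnorm_le (vsub (fun e => if in_dec ceq e L then u e else c0) u) eps.
Proof.
  intros H eps e0.
  set (E := fun r => exists L, NoDup L /\ r = rsum (map (fun e => cabs2 (u e)) L)).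
  destruct (completeness E) as [S [ub lub]].
  - exists B. intros r (L & n & ->). auto.
  - exists 0, []. split; [constructor|reflexivity].
  - assert (X : exists L, NoDup L /\ S - eps < rsum (map (fun e => cabs2 (u e)) L)).
    { apply NNPP; intros h. assert (S <= S - eps); [|lra]. apply lub.
      intros r (L & n & ->). apply Rnot_lt_le; intros h'. apply h; eauto. }
    destruct X as (L & n & hL). exists L. intros L' n'.
    set (p := fun e => if in_dec ceq e L then false else true).
    rewrite (rsum_ext _ (fun e => if p e then cabs2 (u e) else 0)).
    + rewrite <- (rsum_filter p (fun e => cabs2 (u e))).
      assert (U : rsum (map (fun e => cabs2 (u e)) (L ++ filter p L')) <= S).
      { apply ub. exists (L ++ filter p L'). split; auto.
        apply NoDup_app; [auto|now apply NoDup_filter|].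
        intros e h. unfold p. rewrite filter_In.
        destruct (in_dec ceq e L); intuition congruence. }
      rewrite map_app, rsum_app in U. lra.
    + intros e _. unfold vsub, p. destruct (in_dec ceq e L);
        unfold csub, cabs2, c0; simpl; ring.
Qed.

(** * Bonds in boxes *)

Lemma zrange_In n z : In z (zrange n) <-> (Z.abs z <= Z.of_nat n)%Z.
Proof.
  unfold zrange. rewrite in_map_iff. split.
  - intros (k & <- & h). apply in_seq in h. lia.
  - intros h. exists (Z.to_nat (z + Z.of_nat n)). rewrite in_seq. lia.
Qed.

Lemma zrange_NoDup n : NoDup (zrange n).
Proof.
  apply FinFun.Injective_map_NoDup; [|apply seq_NoDup]. intros x y h. lia.
Qed.

Lemma box_bonds_In n x d : In (x, d) (box_bonds n) <->
  (Z.abs (fst x) <= Z.of_nat n /\ Z.abs (snd x) <= Z.of_nat n)%Z.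
Proof.
  unfold box_bonds. rewrite in_flat_map. rewrite <- !zrange_In. split.
  - intros (a & ha & h). apply in_flat_map in h as (b & hb & h).
    destruct h as [h|[h|[]]]; injection h; intros <- <-; auto.
  - intros [h h']. exists (fst x). split; auto. apply in_flat_map. exists (snd x).
    split; auto. destruct x, d; simpl; auto.
Qed.

(** The map [p] recovers the block to which an element belongs, so distinct blocks are disjoint. *)
Lemma NoDup_flat_map {A B : Type} (f : A -> list B) (p : B -> A) l :
  NoDup l -> (forall a, NoDup (f a)) -> (forall a b, In b (f a) -> p b = a) ->
  NoDup (flat_map f l).
Proof.
  intros n nf hp. induction n as [|a l i n IH]; simpl; [constructor|].
  apply NoDup_app; auto. intros b h h'. apply in_flat_map in h' as (a' & i' & h').
  apply hp in h. apply hp in h'. congruence.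
Qed.

(** Each bond is counted once in a box sum, so that [fsumE] can identify this sum with the full
    one. *)
Lemma box_bonds_NoDup n : NoDup (box_bonds n).
Proof.
  apply (NoDup_flat_map _ (fun b => fst (fst b))); [apply zrange_NoDup| |].
  - intros a. apply (NoDup_flat_map _ (fun b => snd (fst b))); [apply zrange_NoDup| |].
    + intros b. constructor; [|constructor; [easy|constructor]].
      intros [h|[]]. congruence.
    + intros b x [h|[h|[]]]; subst; reflexivity.
  - intros a x h. apply in_flat_map in h as (b & _ & [h|[h|[]]]); subst; reflexivity.
Qed.

Lemma bonds_in_box (l : list bond) : exists N, forall n, (N <= n)%nat ->
  forall b, In b l -> In b (box_bonds n).
Proof.
  induction l as [|[x d] l [N IH]].
  - exists 0%nat. easy.
  - exists (N + Z.to_nat (Z.abs (fst x)) + Z.to_nat (Z.abs (snd x)))%nat.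
    intros n h b [<-|i]; [apply box_bonds_In; lia|apply IH; auto; lia].
Qed.

(** * The Hamiltonian on complex vectors and its closure *)

Section Model.
Context (m1 m2 l1 l2 : R).
Notation D := (inDb m1 m2).
Definition lam_of (d : bool) : R := if d then l2 else l1.
Notation coreD := (core D).
Notation tb := (bond_term D lam_of).
Notation Hop := (ham D lam_of).

Lemma inDP x : inD m1 m2 x <-> D x = true.
Proof. unfold inD, inDb. destruct (Rle_dec _ _); intuition congruence. Qed.

Lemma validP eta : valid_cfg m1 m2 eta <-> finite_cfg eta /\ forall x, eta x = true -> D x = true.
Proof.
  unfold valid_cfg, finite_cfg. split; intros [h h']; split; auto; intros x e; apply inDP; auto.
Qed.

Definition corev (u : vec) : Prop := coreD (re u) /\ coreD (im u).

(** Connects the real-valued [core] with the complex vectors on which the operator is initially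
    given. *)
Lemma corev_iff u : corev u <->
  fin_supp u /\ forall e, ~ valid_cfg m1 m2 e -> u e = c0.
Proof.
  split.
  - intros [[[L h] v] [[L' h'] v']].
    assert (N : forall e, u e <> c0 -> re u e <> 0 \/ im u e <> 0).
    { intros e n. unfold re, im. apply NNPP; intros H. apply n.
      rewrite (surjective_pairing (u e)). unfold c0.
      f_equal; apply NNPP; intros H'; apply H; auto. }
    split.
    + exists (L ++ L'). intros e n. apply in_or_app. destruct (N e n); auto.
    + intros e n. apply NNPP; intros n'. apply n, validP. destruct (N e n'); auto.
  - intros [[L h] v]. assert (N : forall e, fst (u e) <> 0 \/ snd (u e) <> 0 -> u e <> c0).
    { intros e n E. rewrite E in n. destruct n as [n|n]; now apply n. }
    split; (split; [exists L; unfold re, im; intros; apply h, N; auto|]);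
      unfold re, im; intros e n; apply validP, NNPP; intros n'; apply v in n';
      apply (N e); auto.
Qed.

Lemma corev_l2 u : fin_supp u -> in_l2 m1 m2 u -> corev u.
Proof. intros h [v _]. now apply corev_iff. Qed.

Lemma corev_vl a u c v : corev u -> corev v -> corev (vlin a u c v).
Proof. intros [h1 h2] [h3 h4]. split; [apply (core_lin D a c (re u) (re v))
  |apply (core_lin D a c (im u) (im v))]; auto. Qed.

Definition sqn (u : vec) : R := sq (re u) + sq (im u).

Lemma sqnorm_sqn u r : corev u -> sqnorm_le u r <-> sqn u <= r.
Proof.
  intros [[h _] [h' _]].
  pose proof (finsupp_sq _ h) as k. pose proof (finsupp_sq _ h') as k'.
  assert (E : sqn u = fsum (fun e => cabs2 (u e))).
  { unfold sqn, sq. rewrite <- fsum_plus by auto. f_equal; extensionality e.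
    unfold cabs2, re, im. ring. }
  assert (F : finsupp (fun e => cabs2 (u e))).
  { apply (finsupp_imp2 _ _ _ h h'). intros e n. unfold re, im. apply NNPP; intros H.
    apply n. unfold cabs2. destruct (classic (fst (u e) = 0)) as [->|]; [|tauto].
    destruct (classic (snd (u e) = 0)) as [->|]; [ring|tauto]. }
  rewrite E. split; intros H.
  - destruct (finsupp_list _ F) as (L & n & s). rewrite (fsumE _ L); auto.
  - intros L n. apply (Rle_trans _ _ _ (rsum_le_fsum _ L F n (fun e => cabs2_nonneg _)) H).
Qed.

Lemma in_l2_fsvv u : corev u -> in_l2 m1 m2 u.
Proof.
  intros h. split; [now apply corev_iff|]. exists (sqn u). apply sqnorm_sqn; auto. lra.
Qed.

Lemma in_l2_vl a u c v : in_l2 m1 m2 u -> in_l2 m1 m2 v -> in_l2 m1 m2 (vlin a u c v).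
Proof.
  intros [h [B b]] [h' [B' b']]. split.
  - intros e n. unfold vlin. rewrite (h e n), (h' e n). unfold c0; simpl. f_equal; ring.
  - eexists; eapply sqnorm_vl; eauto.
Qed.

Lemma in_l2_conv s u : (forall n, in_l2 m1 m2 (s n)) -> conv s u -> in_l2 m1 m2 u.
Proof.
  intros cs c. split.
  - intros e n. apply cabs2_0. apply Rnot_lt_le; intros h.
    destruct (c (cabs2 (u e) / 2)) as [N hN]; [lra|]. specialize (hN N (le_n N)).
    apply (sqnorm_point _ _ e) in hN. unfold vsub in hN.
    rewrite (proj1 (cs N) e n) in hN. unfold csub, c0, cabs2 in *; simpl in hN. nra.
  - destruct (c 1 Rlt_0_1) as [N hN]. specialize (hN N (le_n N)).
    destruct (proj2 (cs N)) as [B b].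
    replace u with (vlin 1 (s N) (-1) (vsub (s N) u)) by vring.
    eexists; eapply sqnorm_vl; eauto.
Qed.

Definition HamV (u : vec) : vec := fun e => (Hop (re u) e, Hop (im u) e).

Lemma HamV_vl a u c v : corev u -> corev v ->
  HamV (vlin a u c v) = vlin a (HamV u) c (HamV v).
Proof.
  intros [h1 h2] [h3 h4]. extensionality e. unfold HamV, vlin.
  change (re (fun e => (a * fst (u e) + c * fst (v e), _)))
    with (fun e => a * re u e + c * re v e).
  change (im (fun e => (_, a * snd (u e) + c * snd (v e))))
    with (fun e => a * im u e + c * im v e).
  now rewrite !ham_lin.
Qed.

Lemma corev_HamV u : corev u -> corev (HamV u).
Proof.
  intros [h h'].
  split; [apply (core_ham D lam_of (re u))|apply (core_ham D lam_of (im u))]; auto.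
Qed.

Lemma Hbox_rsum n psi eta : Hbox m1 m2 l1 l2 n psi eta
  = (rsum (map (fun b => tb b (re psi) eta) (box_bonds n)),
     rsum (map (fun b => tb b (im psi) eta) (box_bonds n))).
Proof.
  unfold Hbox. induction (box_bonds n) as [|[x d] l IH]; [reflexivity|].
  simpl map. unfold csum, rsum in *. simpl fold_right. rewrite IH.
  unfold cadd, bond_term, src, tgt, lam_of. simpl.
  rewrite hb_apply_bond_op. destruct (D x && D (shift x d))%bool; reflexivity.
Qed.

(** Only finitely many bonds act nontrivially on [psi]; once the box contains them, its sum is the
    full sum. *)
Lemma Hbox_eventually psi eta : corev psi ->
  exists N, forall n, (N <= n)%nat -> HamV psi eta = Hbox m1 m2 l1 l2 n psi eta.
Proof.
  intros [h h'].
  destruct (bond_term_supp D lam_of _ h) as (L & B & s).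
  destruct (bond_term_supp D lam_of _ h') as (L' & B' & s').
  destruct (bonds_in_box (B ++ B')) as [N H]. exists N. intros n l.
  rewrite Hbox_rsum. unfold HamV, ham.
  f_equal; apply fsumE; try apply box_bonds_NoDup; intros b z; apply (H n l), in_or_app.
  - left; now apply s in z.
  - right; now apply s' in z.
Qed.

(** On the core the relation [H0] thus becomes the graph of a function, and the closure can be
    described by sequences in the core alone, as in [HD_seq]. *)
Lemma H0_HamV psi phi : corev psi -> H0 m1 m2 l1 l2 psi phi <-> phi = HamV psi.
Proof.
  intros h. pose proof (corev_HamV psi h) as hH. apply corev_iff in hH as [_ hH]. split.
  - intros H. extensionality eta. destruct (H eta) as [v nv].
    destruct (classic (valid_cfg m1 m2 eta)) as [V|V].
    + destruct (v V) as [N hN]. destruct (Hbox_eventually psi eta h) as [N' hN'].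
      rewrite (hN (max N N')), (hN' (max N N')) by lia. reflexivity.
    + rewrite nv, hH; auto.
  - intros -> eta. split; auto. intros _. now apply Hbox_eventually.
Qed.

Lemma HD_seq psi chi : HD m1 m2 l1 l2 psi chi <->
  in_l2 m1 m2 psi /\ in_l2 m1 m2 chi /\
  exists s, (forall n, corev (s n)) /\ conv s psi /\ conv (fun n => HamV (s n)) chi.
Proof.
  split; intros (h & h' & H); split; auto; split; auto.
  - destruct H as (s & t & A & c & c'). exists s.
    assert (F : forall n, corev (s n)).
    { intros n. destruct (A n) as (a & b & _). now apply corev_l2. }
    split; auto. split; auto. replace (fun n => HamV (s n)) with t; auto.
    extensionality n. apply H0_HamV; auto. apply A.
  - destruct H as (s & F & c & c'). exists s, (fun n => HamV (s n)). split; auto.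
    intros n. split; [now apply in_l2_fsvv|]. split; [now apply corev_iff|].
    now apply H0_HamV.
Qed.

Lemma HD_sub psi chi psi' chi' : HD m1 m2 l1 l2 psi chi -> HD m1 m2 l1 l2 psi' chi' ->
  HD m1 m2 l1 l2 (vlin 1 psi (-1) psi') (vlin 1 chi (-1) chi').
Proof.
  rewrite !HD_seq. intros (h & k & s & F & c & d) (h' & k' & s' & F' & c' & d').
  split; [now apply in_l2_vl|]. split; [now apply in_l2_vl|].
  exists (fun n => vlin 1 (s n) (-1) (s' n)). split; [intros; now apply corev_vl|].
  split; [now apply conv_vl|].
  replace (fun n => HamV (vlin 1 (s n) (-1) (s' n)))
    with (fun n => vlin 1 (HamV (s n)) (-1) (HamV (s' n))); [now apply conv_vl|].
  extensionality n. now rewrite HamV_vl.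
Qed.

(** * Points of the gap belong to the resolvent set *)

Context (delta : R).
Hypothesis form : forall f, coreD f -> delta * (sq f - f vac ^ 2) <= energy_form D lam_of f.
Context (mu : R).
Hypothesis mu_gap : 0 < mu < delta.

Definition AV (u : vec) : vec := vlin 1 (HamV u) (- mu) u.

Lemma corev_AV u : corev u -> corev (AV u).
Proof. intros h. apply corev_vl; auto. now apply corev_HamV. Qed.

Lemma AV_bound : exists K, 0 <= K /\
  forall u r, corev u -> sqnorm_le (AV u) r -> sqnorm_le u (K * r).
Proof.
  set (K := / (delta - mu) ^ 2 + / mu ^ 2).
  assert (K0 : 0 <= K).
  { unfold K. apply Rplus_le_le_0_compat; left; apply Rinv_0_lt_compat; nra. }
  exists K. split; auto. intros u r h H.
  apply sqnorm_sqn in H; [|now apply corev_AV]. apply sqnorm_sqn; auto.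
  pose proof (Amu_bounded_below D lam_of delta form mu mu_gap _ (proj1 h)) as h1.
  pose proof (Amu_bounded_below D lam_of delta form mu mu_gap _ (proj2 h)) as h2.
  fold K in h1, h2.
  apply (Rle_trans _ (K * sqn (AV u))); [|now apply Rmult_le_compat_l].
  unfold sqn. rewrite Rmult_plus_distr_l. now apply Rplus_le_compat.
Qed.

(** The lower bound passes from the core to the closure by approximation. The factor 4 comes from
    two uses of [sqnorm_vl], each doubling the main term. *)
Lemma HD_bound : exists K, 0 <= K /\ forall psi chi r, HD m1 m2 l1 l2 psi chi ->
  sqnorm_le (vlin 1 chi (- mu) psi) r -> sqnorm_le psi (K * r).
Proof.
  destruct AV_bound as (K & K0 & H). exists (4 * K). split; [lra|].
  intros psi chi r hd hr. apply HD_seq in hd as (_ & _ & s & F & c & d).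
  (* The total coefficient of [eps] when [psi] and [chi] are both approximated up to [eps]. *)
  set (c1 := 2 * K * (2 * (2 + 2 * mu ^ 2)) + 2).
  pose proof (pow2_ge_0 mu) as mu2.
  assert (c10 : 0 <= c1) by (unfold c1; nra).
  apply (sqnorm_lim _ _ c1); auto. intros eps e0.
  destruct (c eps e0) as [N hN]. destruct (d eps e0) as [N' hN'].
  set (n := max N N'). specialize (hN n ltac:(lia)). specialize (hN' n ltac:(lia)).
  pose proof (sqnorm_vl 1 _ (- mu) _ _ _ hN' hN) as e1.
  pose proof (sqnorm_vl 1 _ 1 _ _ _ hr e1) as e2.
  replace (vlin 1 _ 1 _) with (AV (s n)) in e2.
  - apply H in e2; auto. pose proof (sqnorm_vl 1 _ (-1) _ _ _ e2 hN) as e3.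
    replace (vlin 1 (s n) (-1) (vsub (s n) psi)) with psi in e3 by vring.
    apply (sqnorm_mono _ _ _ e3). right. unfold c1. ring.
  - unfold AV. vring.
Qed.

(** First [phi] is truncated to finite support, then the equation is solved approximately for the
    real and the imaginary part. The truncation and the solution each cost [eps / 4], and
    [sqnorm_vl] doubles both. *)
Lemma AV_dense phi : in_l2 m1 m2 phi -> forall eps, 0 < eps ->
  exists u, corev u /\ sqnorm_le (vlin 1 (AV u) (-1) phi) eps.
Proof.
  intros [v [B b]] eps e0.
  destruct (truncation phi B b (eps / 4)) as [L hL]; [lra|].
  set (phi' := fun e => _) in hL.
  assert (F : corev phi').
  { apply corev_iff. unfold phi'. split.
    - exists L. intros e. destruct (in_dec ceq e L); congruence.
    - intros e n. destruct (in_dec ceq e L); auto. }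
  destruct (dense_range D lam_of delta form mu mu_gap _ (proj1 F) (eps / 8)) as (f & hf & le);
    [lra|].
  destruct (dense_range D lam_of delta form mu mu_gap _ (proj2 F) (eps / 8)) as (g & hg & le');
    [lra|].
  set (u := (fun e => (f e, g e)) : vec). assert (U : corev u) by now split.
  exists u. split; auto.
  assert (H : sqnorm_le (vlin 1 (AV u) (-1) phi') (eps / 4)).
  { apply sqnorm_sqn; [apply corev_vl; auto; now apply corev_AV|].
    apply (Rle_trans _ (eps / 8 + eps / 8)); [|lra]. now apply Rplus_le_compat. }
  pose proof (sqnorm_vl 1 _ 1 _ _ _ H hL) as K.
  replace (vlin 1 _ 1 _) with (vlin 1 (AV u) (-1) phi) in K by vring.
  apply (sqnorm_mono _ _ _ K). lra.
Qed.

(** Approximate solutions [s n] with residual tending to zero are Cauchy by [AV_bound]. Their limit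
    is in the domain of the closure because [HamV (s n) = AV (s n) + mu * s n] also converges. *)
Lemma HD_surjective phi : in_l2 m1 m2 phi ->
  exists psi, HD m1 m2 l1 l2 psi (vlin 1 phi mu psi).
Proof.
  intros h.
  assert (X : forall n : nat, {u | corev u /\
    sqnorm_le (vlin 1 (AV u) (-1) phi) (/ INR (S n))}).
  { intros n. apply constructive_indefinite_description, AV_dense; auto.
    apply Rinv_0_lt_compat, lt_0_INR; lia. }
  set (s := fun n => proj1_sig (X n)).
  assert (F : forall n, corev (s n)) by (intros n; apply (proj2_sig (X n))).
  assert (A : forall n, sqnorm_le (vlin 1 (AV (s n)) (-1) phi) (/ INR (S n)))
    by (intros n; apply (proj2_sig (X n))).
  destruct AV_bound as (K & K0 & H).
  assert (I : forall N n, (N <= n)%nat -> / INR (S n) <= / INR (S N)).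
  { intros N n l. apply Rinv_le_contravar; [apply lt_0_INR; lia|apply le_INR; lia]. }
  assert (small : forall eps, 0 < eps -> exists N, / INR (S N) <= eps).
  { intros eps e0. destruct (archimed_cor1 eps e0) as (N & l & p). exists N.
    left. apply (Rle_lt_trans _ (/ INR N)); auto.
    apply Rinv_le_contravar; [now apply lt_0_INR|apply le_INR; lia]. }
  destruct (l2_complete s) as [psi c].
  (* Two residuals of size [eps / (4 * K + 1)] give a difference of at most four times that size,
     which [AV_bound] multiplies by [K]; the [+ 1] keeps the denominator positive. *)
  { intros eps e0. destruct (small (eps / (4 * K + 1))) as [N hN];
      [apply Rdiv_lt_0_compat; lra|].
    exists N. intros n m hn hm.
    pose proof (sqnorm_vl 1 _ (-1) _ _ _ (A n) (A m)) as e.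
    replace (vlin 1 _ (-1) _) with (AV (vlin 1 (s n) (-1) (s m))) in e.
    - apply H in e; [|now apply corev_vl]. rewrite vsub_vl.
      apply (sqnorm_mono _ _ _ e).
      pose proof (I N n hn). pose proof (I N m hm).
      apply (Rle_trans _ (K * (4 * (eps / (4 * K + 1))))).
      + apply Rmult_le_compat_l; auto. lra.
      + replace eps with ((4 * K + 1) * (eps / (4 * K + 1))) at 2 by (field; lra).
        assert (0 < eps / (4 * K + 1)) by (apply Rdiv_lt_0_compat; lra). lra.
    - unfold AV. rewrite HamV_vl by auto. vring. }
  exists psi. apply HD_seq.
  assert (P : in_l2 m1 m2 psi).
  { apply (in_l2_conv s); auto. intros n; now apply in_l2_fsvv. }
  split; auto. split; [now apply in_l2_vl|]. exists s. split; auto. split; auto.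
  replace (fun n => HamV (s n)) with (fun n => vlin 1 (AV (s n)) mu (s n)).
  - apply conv_vl; auto. intros eps e0. destruct (small eps e0) as [N hN].
    exists N. intros n l. rewrite vsub_vl. apply (sqnorm_mono _ _ _ (A n)).
    specialize (I N n l). lra.
  - extensionality n. unfold AV. vring.
Qed.

Lemma resolvent_HD : resolvent m1 m2 (HD m1 m2 l1 l2) mu.
Proof.
  destruct HD_bound as (K & K0 & H). split; [|split].
  - intros phi h. destruct (HD_surjective phi h) as [psi hd].
    exists psi, (vlin 1 phi mu psi). split; auto. vring.
  - intros psi1 chi1 psi2 chi2 h1 h2 E. rewrite !vsub_vscale in E.
    (* Injectivity is the lower bound with right side zero, applied to the difference of the two
       solutions. *)
    assert (Z : sqnorm_le (vlin 1 psi1 (-1) psi2) (K * 0)).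
    { apply (H _ _ _ (HD_sub _ _ _ _ h1 h2)).
      replace (vlin 1 _ _ _)
        with (vlin 1 (vlin 1 chi1 (- mu) psi1) (-1) (vlin 1 chi1 (- mu) psi1)).
      - intros L _. right. apply rsum_zero. intros e _. unfold vlin, cabs2; simpl; ring.
      - rewrite E at 2. vring. }
    rewrite Rmult_0_r in Z. extensionality e. apply (sqnorm_point _ _ e) in Z.
    apply cabs2_0 in Z. unfold vlin, c0 in Z. injection Z; intros z2 z1.
    rewrite (surjective_pairing (psi1 e)), (surjective_pairing (psi2 e)). f_equal; lra.
  - exists K. split; auto. intros psi chi r hd. rewrite vsub_vscale. eauto.
Qed.

End Model.

(** * Lattice directions *)

Lemma mulv_abs z d : mulv (Z.abs_nat z) d (0 <=? z)%Z = if d then (0%Z, z) else (z, 0%Z).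
Proof.
  unfold mulv. destruct (Z.leb_spec 0 z), d; f_equal; lia.
Qed.

Lemma adm_halfplane m1 m2 w :
  0 <= m1 * IZR (fst w) + m2 * IZR (snd w) -> admissible (inDb m1 m2) w.
Proof.
  intros h x. unfold inDb, sadd; simpl. rewrite !plus_IZR.
  destruct (Rle_dec _ _) as [a|]; [|discriminate]. intros _.
  destruct (Rle_dec _ _) as [|n]; [reflexivity|]. elim n. lra.
Qed.

(** An affine function that is nonnegative at both ends of a segment is nonnegative in between. This
    keeps a whole leg of the staircase admissible once its ends are. *)
Lemma segment_nonneg a c z j : 0 <= c -> 0 <= c + a * IZR z -> (j <= Z.abs_nat z)%nat ->
  0 <= c + a * IZR (if (0 <=? z)%Z then Z.of_nat j else (- Z.of_nat j)%Z).
Proof.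
  intros h h' l. set (y := if (0 <=? z)%Z then _ else _).
  assert (E : (0 <= y <= z \/ z <= y <= 0)%Z)
    by (unfold y; destruct (Z.leb_spec 0 z); lia).
  destruct (Rle_dec 0 a) as [s|s]; destruct E as [[e e']|[e e']];
    apply IZR_le in e, e'; nra.
Qed.

Lemma round_near r : exists z, Rabs (IZR z - r) <= 1.
Proof.
  exists (Int_part r). destruct (base_Int_part r). apply Rabs_le. lra.
Qed.

(* The direction [L + |L| m] has positive product with both [L] and [m]: these are
   [|L| c] and [c] for [c = |L| + m . L], and [|L + |L| m|^2 = 2 |L| c]. *)
Lemma good_direction L1 L2 m1 m2 : m1 ^ 2 + m2 ^ 2 = 1 ->
  (L1, L2) <> (- sqrt (L1 ^ 2 + L2 ^ 2) * m1, - sqrt (L1 ^ 2 + L2 ^ 2) * m2) ->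
  exists v1 v2 : Z, 0 <= m1 * IZR v1 + m2 * IZR v2 /\ 0 < L1 * IZR v1 + L2 * IZR v2.
Proof.
  intros hm hL.
  assert (q0 : 0 <= L1 ^ 2 + L2 ^ 2)
    by (pose proof (pow2_ge_0 L1); pose proof (pow2_ge_0 L2); lra).
  pose proof (sqrt_sqrt _ q0) as hn. pose proof (sqrt_pos (L1 ^ 2 + L2 ^ 2)) as n0.
  set (n := sqrt _) in *.
  set (c := n + (m1 * L1 + m2 * L2)).
  assert (E : (L1 + n * m1) ^ 2 + (L2 + n * m2) ^ 2 = 2 * n * c).
  { transitivity (L1 ^ 2 + L2 ^ 2 + 2 * n * (m1 * L1 + m2 * L2) + n ^ 2 * (m1 ^ 2 + m2 ^ 2));
      [ring|]. rewrite hm, <- hn. unfold c; ring. }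
  assert (P : 0 < n * c).
  (* Otherwise the squared length of [L + n m] is at most zero, so [L = - n m], which is the
     excluded direction. *)
  { apply Rnot_le_lt; intros h. apply hL.
    pose proof (pow2_ge_0 (L1 + n * m1)). pose proof (pow2_ge_0 (L2 + n * m2)).
    assert (L1 + n * m1 = 0) by (apply Rsqr_0_uniq; unfold Rsqr; lra).
    assert (L2 + n * m2 = 0) by (apply Rsqr_0_uniq; unfold Rsqr; lra).
    f_equal; lra. }
  assert (n1 : 0 < n) by (destruct n0 as [|z]; [auto|rewrite <- z in P; lra]).
  assert (c1 : 0 < c) by (apply (Rmult_lt_reg_l n); lra).
  set (A := Rabs m1 + Rabs m2). set (B := Rabs L1 + Rabs L2).
  assert (A0 : 0 <= A) by (unfold A; pose proof (Rabs_pos m1); pose proof (Rabs_pos m2); lra).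
  assert (B0 : 0 <= B) by (unfold B; pose proof (Rabs_pos L1); pose proof (Rabs_pos L2); lra).
  (* Rounding the coordinates changes the products with [m] and [L] by at most [A] and [B]. The real
     direction is therefore stretched until its products [T * c] and [T * (n * c)] absorb these
     errors, the second one strictly. *)
  set (T := A / c + (B + 1) / (n * c)).
  assert (Tc : A <= T * c).
  { replace (T * c) with (A + (B + 1) / n) by (unfold T; field; lra).
    assert (0 < (B + 1) / n) by (apply Rdiv_lt_0_compat; lra). lra. }
  assert (Tn : B < T * (n * c)).
  { replace (T * (n * c)) with (A * n + B + 1) by (unfold T; field; lra). nra. }
  destruct (round_near (T * (L1 + n * m1))) as [v1 h1].
  destruct (round_near (T * (L2 + n * m2))) as [v2 h2].
  assert (bound : forall a b, - (Rabs a + Rabs b) <=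
     a * (IZR v1 - T * (L1 + n * m1)) + b * (IZR v2 - T * (L2 + n * m2))).
  { intros a b.
    assert (Q : forall x y, Rabs y <= 1 -> - Rabs x <= x * y).
    { intros x y hy. pose proof (Rabs_pos x). pose proof (Rle_abs (- (x * y))) as K.
      rewrite Rabs_Ropp, Rabs_mult in K. nra. }
    pose proof (Q a _ h1). pose proof (Q b _ h2). lra. }
  exists v1, v2. split.
  - pose proof (bound m1 m2) as K. fold A in K.
    assert (m1 * (T * (L1 + n * m1)) + m2 * (T * (L2 + n * m2)) = T * c); [|lra].
    transitivity (T * ((m1 * L1 + m2 * L2) + n * (m1 ^ 2 + m2 ^ 2))); [ring|].
    rewrite hm. unfold c; ring.
  - pose proof (bound L1 L2) as K. fold B in K.
    assert (L1 * (T * (L1 + n * m1)) + L2 * (T * (L2 + n * m2)) = T * (n * c)); [|lra].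
    transitivity (T * ((L1 ^ 2 + L2 ^ 2) + n * (m1 * L1 + m2 * L2))); [ring|].
    rewrite <- hn. unfold c; ring.
Qed.

Theorem theorem4p1 (l1 l2 m1 m2 : R) :
  0 < l1 -> 0 < l2 -> m1 ^ 2 + m2 ^ 2 = 1 ->
  (ln l1, ln l2) <>
    (- sqrt (ln l1 ^ 2 + ln l2 ^ 2) * m1, - sqrt (ln l1 ^ 2 + ln l2 ^ 2) * m2) ->
  gap_pos m1 m2 (HD m1 m2 l1 l2).
Proof.
  intros p1 p2 hm hL.
  destruct (good_direction _ _ _ _ hm hL) as (v1 & v2 & hv & hl).
  assert (lam_pos : forall d, 0 < lam_of l1 l2 d) by (intros []; auto).
  assert (G : exists delta, 0 < delta /\ forall f, core (inDb m1 m2) f ->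
    delta * (sq f - f vac ^ 2) <= energy_form (inDb m1 m2) (lam_of l1 l2) f).
  (* The order of the two legs is chosen so that the corner of the staircase is admissible: if
     [m1 * v1] is negative, then [m2 * v2] is positive, because their sum is nonnegative. *)
  { destruct (Rle_dec 0 (m1 * IZR v1)) as [h|h].
    - apply (form_gap _ _ lam_pos false (0 <=? v1)%Z (Z.abs_nat v1)
               true (0 <=? v2)%Z (Z.abs_nat v2)).
      + rewrite !mulv_abs. unfold dot, sadd; simpl. rewrite Z.add_0_r. auto.
      + intros j hj. apply adm_halfplane. simpl.
        pose proof (segment_nonneg m1 0 v1 j ltac:(lra) ltac:(lra) hj). lra.
      + intros j hj. apply adm_halfplane. rewrite mulv_abs. simpl. rewrite Z.add_0_r.
        now apply segment_nonneg.
    - apply (form_gap _ _ lam_pos true (0 <=? v2)%Z (Z.abs_nat v2)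
               false (0 <=? v1)%Z (Z.abs_nat v1)).
      + rewrite !mulv_abs. unfold dot, sadd; simpl. rewrite Z.add_0_r. auto.
      + intros j hj. apply adm_halfplane. simpl.
        pose proof (segment_nonneg m2 0 v2 j ltac:(lra) ltac:(lra) hj). lra.
      + intros j hj. apply adm_halfplane. rewrite mulv_abs. simpl. rewrite Z.add_0_r.
        rewrite Rplus_comm. apply segment_nonneg; auto; lra. }
  destruct G as (delta & d0 & form).
  exists delta. split; auto. intros mu hmu H. apply H.
  exact (resolvent_HD m1 m2 l1 l2 delta form mu hmu).
Qed.
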